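(* Let $d\ge1$ and let $\psi\in L^1(\mathbb R^d)\cap L^\infty(\mathbb R^d)$ be real-valued with $\widehat\psi(0)\ge0$, and let $a=\|\psi\|_{L^\infty}$, $b=\|\psi\|_{L^1}$, and $c>0$ be such that $c|\widehat\psi(\xi)|\ge1$ for all $\xi\in B^d_1$. Let $f\in PW_d\setminus\{0\}$ satisfy $\int_{\mathbb R^d}f\le0$, and set $T_\psi(f)=f*\psi$. Then $$|\{x\in\mathbb R^d: f(x)<0\}|\cdot|\{\xi\in\mathbb R^d: T_\psi(f)(\xi)<0\}|\ \ge\ (16a^2b^2c^4)^{-1}.$$ In particular, if there are $r_1,r_2>0$ with $f(x)\ge0$ for $|x|\ge r_1$ and $T_\psi(f)(\xi)\ge0$ for $|\xi|\ge r_2$, then $r_1r_2\ge(16a^2b^2c^4|B^d_1|^2)^{-1/d}$.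
   Context: $\widehat f(\xi)=\int_{\mathbb R^d}f(x)e^{-2\pi i\langle x,\xi\rangle}dx$. $B^d_1$ is the closed unit ball in $\mathbb R^d$ centered at $0$, $|E|$ denotes Lebesgue measure. $PW_d$ is the set of real-valued continuous $f\in L^1(\mathbb R^d)$ with $\operatorname{supp}\widehat f\subseteq B^d_1$. *)

(* Defs.v *)
From HB Require Import structures.
From mathcomp Require Import all_boot all_order all_algebra.
From mathcomp Require Import all_classical all_reals all_analysis.

Set Implicit Arguments.
Unset Strict Implicit.
Unset Printing Implicit Defensive.

Import Order.TTheory GRing.Theory Num.Theory.
Import numFieldNormedType.Exports.

Local Open Scope classical_set_scope.
Local Open Scope ring_scope.

(* Points of R^d are d-tuples of reals; the measurable structure on
   d.-tuple R is the library's product sigma-algebra of Borel sets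
   (= the Borel sigma-algebra of R^d). *)

Section Rd.
Variables (R : realType) (d : nat).

Definition rd_zero : d.-tuple R := [tuple (0 : R) | _ < d].
Definition rd_sub (x y : d.-tuple R) : d.-tuple R :=
  [tuple tnth x i - tnth y i | i < d].

Definition rd_dot (x y : d.-tuple R) : R := \sum_(i < d) tnth x i * tnth y i.
Definition rd_norm (x : d.-tuple R) : R := Num.sqrt (rd_dot x x).

Definition unit_ball : set (d.-tuple R) := [set x | rd_norm x <= 1].

Definition rd_box (a b : d.-tuple R) : set (d.-tuple R) :=
  [set x | forall i, tnth a i <= tnth x i <= tnth b i].
Definition rd_boxvol (a b : d.-tuple R) : R :=
  \prod_(i < d) (tnth b i - tnth a i).

(* d-dimensional Lebesgue (outer) measure: infimum of the total volume of
   countable covers by closed boxes. On measurable sets it is the Lebesgue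
   measure of R^d. *)
Definition lebesgue_d (A : set (d.-tuple R)) : \bar R :=
  ereal_inf [set (\sum_(0 <= k <oo) ((rd_boxvol (ab.1 k) (ab.2 k))%:E))%E |
    ab in [set ab : (nat -> d.-tuple R) * (nat -> d.-tuple R) |
      (forall k i, tnth (ab.1 k) i <= tnth (ab.2 k) i) /\
      A `<=` \bigcup_k rd_box (ab.1 k) (ab.2 k)]].

Definition rd_integrable (f : d.-tuple R -> R) : Prop :=
  measurable_fun [set: d.-tuple R] f /\
  (\int[lebesgue_d]_x (`|f x|)%:E < +oo)%E.

Definition L1_norm (f : d.-tuple R -> R) : \bar R :=
  (\int[lebesgue_d]_x (`|f x|)%:E)%E.

Definition Linf_norm (f : d.-tuple R -> R) : \bar R :=
  ereal_inf [set y : \bar R | lebesgue_d [set x | (y < (`|f x|)%:E)%E] = 0%E].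

Definition rd_integral (f : d.-tuple R -> R) : R :=
  fine (\int[lebesgue_d]_x (f x)%:E)%E.

(* Fourier transform of a real-valued f :
   \hat f(xi) = int f(x) e^{-2 pi i <x,xi>} dx
              = fourier_re f xi + i * fourier_im f xi *)
Definition fourier_re (f : d.-tuple R -> R) (xi : d.-tuple R) : R :=
  rd_integral (fun x => f x * cos (2 * pi * rd_dot x xi)).
Definition fourier_im (f : d.-tuple R -> R) (xi : d.-tuple R) : R :=
  - rd_integral (fun x => f x * sin (2 * pi * rd_dot x xi)).
Definition fourier_abs (f : d.-tuple R -> R) (xi : d.-tuple R) : R :=
  Num.sqrt (fourier_re f xi ^+ 2 + fourier_im f xi ^+ 2).

Definition fourier_support (f : d.-tuple R -> R) : set (d.-tuple R) :=
  [set xi | forall e : R, 0 < e -> exists eta : d.-tuple R,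
     rd_norm (rd_sub eta xi) < e /\
     (fourier_re f eta != 0 \/ fourier_im f eta != 0)].

Definition rd_continuous (f : d.-tuple R -> R) : Prop :=
  forall x : d.-tuple R, forall e : R, 0 < e -> exists2 del : R, 0 < del &
    forall y, rd_norm (rd_sub y x) < del -> `|f y - f x| < e.

Definition PW (f : d.-tuple R -> R) : Prop :=
  rd_continuous f /\ rd_integrable f /\ fourier_support f `<=` unit_ball.

Definition convol (f psi : d.-tuple R -> R) (xi : d.-tuple R) : R :=
  rd_integral (fun y => f y * psi (rd_sub xi y)).

End Rd.

Arguments unit_ball R d _ : clear implicits.

(* Main.v *)
Require Import Defs.
From HB Require Import structures.
From mathcomp Require Import all_boot all_order all_algebra.
From mathcomp Require Import all_classical all_reals all_analysis.
From mathcomp Require Import measurable_realfun.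
From mathcomp Require Import ring lra.
Import Order.TTheory GRing.Theory Num.Theory.
Import numFieldNormedType.Exports.
Set Implicit Arguments.
Unset Strict Implicit.
Unset Printing Implicit Defensive.
Local Open Scope classical_set_scope.
Local Open Scope ring_scope.

(* Write g = f * psi.  Since f has Fourier support in the unit ball, where
   c |psi^| >= 1, we have |f^| <= c |g^| everywhere, hence
   ||f||_2 <= c ||g||_2.  As f and g have nonpositive integral, the mass of
   each is at most twice that of its negative part, so by Cauchy-Schwarz
   ||f||_1^2 <= 4 |{f < 0}| ||f||_2^2 and ||g||_1^2 <= 4 |{g < 0}| ||g||_2^2.
   The bound follows from ||g||_2^2 <= ||g||_oo ||g||_1 <= a ||f||_1 ||g||_1
   and ||g||_2 <= b ||f||_2.

   The L^2 comparison avoids the Plancherel theorem.  Integrate the pointwise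
   inequality c^2 |g^|^2 >= |f^|^2 >= 2 Re(f^ conj(h^)) - |h^|^2, with h a
   truncation of f, against the weight prod_i exp(-e |xi_i|), whose cosine
   transform is a product of Poisson kernels.  These are an approximate
   identity, and the three terms become integrals of correlations A against
   it; A_{g,g} is bounded by ||g||_2^2, while 2 A_{f,h} - A_{h,h} is bounded
   and continuous at 0, where it is at least ||h||_2^2. *)

(** * Product Lebesgue measure *)

(** [lebesgue_d] is an infimum over box covers, while Fubini and the explicit integrals need a
    product measure. So a product measure is built one coordinate at a time, the covering functional
    is shown to be a measure on Borel sets, and the two are identified there.

    Truncating [f] is forced: a priori [f] is neither bounded nor square integrable, so its own
    autocorrelation need not be bounded or continuous. A bounded continuous truncation h keeps
    A_{f,h} and A_{h,h} finite everywhere, and square integrability of [f] comes out at the end by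
    monotone convergence. The exponential weight is chosen because all its integrals have elementary
    antiderivatives.

    In the constant, 16 is the product of the two factors 4 from Cauchy-Schwarz, c^4 comes from
    squaring ||f||_2^2 <= c^2 ||g||_2^2, and b^2 from trading one ||g||_2^2 for ||f||_2^2, so that
    ||f||_2^4 cancels. An essentially bounded [psi] is first replaced by a bounded one that differs
    from it on a null set only. *)

Section pushforward_bijection.
Context d1 d2 (T1 : measurableType d1) (T2 : measurableType d2) (R : realType).
Variables (m : set T1 -> \bar R) (msf : sigma_finite setT m).
Variables (phi : T1 -> T2) (psi : T2 -> T1).
Hypothesis (mpsi : measurable_fun setT psi).
Hypothesis phiK : cancel phi psi.

(** A pushforward can pile infinite mass onto a point. The measurable left inverse [psi] excludes
    this: it carries an exhaustion [F] of the source to sets whose preimages under [phi] are the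
    [F n] again. *)
Lemma pushforward_sigma_finite : sigma_finite setT (pushforward m phi).
Proof.
have [F FT Ffin] := msf.
exists (fun n => psi @^-1` F n).
  by rewrite -preimage_bigcup -FT preimage_setT.
move=> n; have [mF fF] := Ffin n; split.
  by rewrite -[X in measurable X]setTI; exact: mpsi.
rewrite /pushforward -comp_preimage (_ : _ @^-1` _ = F n)//.
by apply/seteqP; split => x /=; rewrite phiK.
Qed.

End pushforward_bijection.

(** Both exhaustions are taken monotone, so a point of [F n] times [G k] already lies in the
    rectangle of index [maxn n k] and the diagonal rectangles suffice. *)
Lemma product_sigma_finite d1 d2 (T1 : measurableType d1)
    (T2 : measurableType d2) (R : realType)
    (m1 : {sigma_finite_measure set T1 -> \bar R})
    (m2 : {sigma_finite_measure set T2 -> \bar R}) :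
  sigma_finite setT (m1 \x m2)%E.
Proof.
have /sigma_finiteP[F [TF ndF Foo]] := sigma_finiteT m1.
have /sigma_finiteP[G [TG ndG Goo]] := sigma_finiteT m2.
exists (fun n => F n `*` G n); last first.
  move=> k; have [mF fF] := Foo k; have [mG fG] := Goo k.
  split; first exact: measurableX.
  by rewrite product_measure1E// lte_mul_pinfty// ge0_fin_numE.
apply/esym; rewrite -subTset => -[x y] _.
have [n _ Fx] : (\bigcup_i F i) x by rewrite -TF.
have [k _ Gy] : (\bigcup_i G i) y by rewrite -TG.
exists (maxn n k) => //; split.
- by move: x Fx; exact/subsetPset/ndF/leq_maxl.
- by move: y Gy; exact/subsetPset/ndG/leq_maxr.
Qed.

Lemma measurable_prodr d (T : measurableType d) (R : realType) (D : set T)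
    (I : Type) (s : seq I) (h : I -> T -> R) :
  (forall i, measurable_fun D (h i)) ->
  measurable_fun D (fun x => \prod_(i <- s) h i x).
Proof.
move=> mh; elim: s => [|i s IH].
  by under eq_fun do rewrite big_nil; exact: measurable_cst.
by under eq_fun do rewrite big_cons; exact: measurable_funM.
Qed.

Section lebesgue_measures.
Variable R : realType.
Implicit Type d : nat.

(* The library's Lebesgue measure lives on an alias of [R] with another
   display than the one used by the tuple sigma-algebra. *)
Let idR : measurableTypeR R -> R := id.

Let measurable_idR : measurable_fun setT idR.
Proof. exact: measurable_id. Qed.

Definition leb1 : set R -> \bar R := pushforward (@lebesgue_measure R) idR.

Let push1 : {measure set R -> \bar R} :=
  measure_function_pushforward__canonical__measure_function_Measure
    (@lebesgue_measure R) measurable_idR.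

HB.instance Definition _ := isMeasure.Build _ _ _ leb1
  (measure0 push1) (measure_ge0 push1) (@measure_semi_sigma_additive _ _ _ push1).

HB.instance Definition _ := Measure_isSigmaFinite.Build _ _ _ leb1
  (@pushforward_sigma_finite _ _ _ _ _ _ (sigma_finiteT (@lebesgue_measure R)) idR idR
    measurable_idR (fun=> erefl)).

Lemma ge0_integral_leb1 (f : R -> \bar R) : measurable_fun [set: R] f ->
  (forall x, 0 <= f x)%E ->
  (\int[leb1]_x f x = \int[@lebesgue_measure R]_x f x)%E.
Proof.
by move=> mf f0; rewrite ge0_integral_pushforward.
Qed.

Definition cons_rd d (p : R * d.-tuple R) : d.+1.-tuple R :=
  [tuple of p.1 :: p.2].
Definition uncons_rd d (x : d.+1.-tuple R) : R * d.-tuple R :=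
  (thead x, [tuple of behead x]).

Lemma cons_rdK d : cancel (@cons_rd d) (@uncons_rd d).
Proof. by move=> [a x]; congr pair; apply/val_inj. Qed.

Lemma uncons_rdK d : cancel (@uncons_rd d) (@cons_rd d).
Proof. by move=> x; rewrite /cons_rd /= -tuple_eta. Qed.

Lemma measurable_cons_rd d : measurable_fun setT (@cons_rd d).
Proof. exact: measurable_cons. Qed.

Lemma measurable_uncons_rd d : measurable_fun setT (@uncons_rd d).
Proof.
apply: measurable_fun_pair; last exact: measurable_behead.
exact: (measurable_tnth ord0).
Qed.

Section cons_measure.
Variables (d : nat) (m : {sigma_finite_measure set (d.-tuple R) -> \bar R}).

Definition cons_measure : set (d.+1.-tuple R) -> \bar R :=
  pushforward (leb1 \x m)%E (@cons_rd d).

Let pushm : {measure set (d.+1.-tuple R) -> \bar R} :=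
  measure_function_pushforward__canonical__measure_function_Measure
    (leb1 \x m)%E (@measurable_cons_rd d).

HB.instance Definition _ := isMeasure.Build _ _ _ cons_measure
  (measure0 pushm) (measure_ge0 pushm) (@measure_semi_sigma_additive _ _ _ pushm).

HB.instance Definition _ := Measure_isSigmaFinite.Build _ _ _ cons_measure
  (@pushforward_sigma_finite _ _ _ _ _ _ (product_sigma_finite leb1 m) _ _
    (@measurable_uncons_rd d) (@cons_rdK d)).

End cons_measure.

(** The base case is a unit mass at the only point of R^0, in agreement with the empty product of
    side lengths. The recursion lets Tonelli peel off the first coordinate, the induction pattern of
    the product integrals below. *)
Fixpoint prod_lebesgue d : {sigma_finite_measure set (d.-tuple R) -> \bar R} :=
  match d with
  | 0 => @dirac _ (0.-tuple R) [tuple] R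
  | d'.+1 => cons_measure (prod_lebesgue d')
  end.

Lemma ge0_integral_prod_lebesgueS d (F : d.+1.-tuple R -> \bar R) :
  measurable_fun setT F -> (forall x, 0 <= F x)%E ->
  (\int[prod_lebesgue d.+1]_x F x =
   \int[leb1]_t \int[prod_lebesgue d]_x F (cons_rd (t, x)))%E.
Proof.
move=> mF F0; rewrite /= ge0_integral_pushforward//=; last exact: measurable_cons_rd.
rewrite preimage_setT fubini_tonelli1//.
by apply: measurableT_comp => //; exact: measurable_cons_rd.
Qed.

Lemma ge0_integral_prod_lebesgue d (phi : 'I_d -> R -> R) :
  (forall i, measurable_fun setT (phi i)) -> (forall i t, 0 <= phi i t) ->
  (\int[prod_lebesgue d]_x (\prod_(i < d) phi i (tnth x i))%:E =
   \prod_(i < d) \int[leb1]_t (phi i t)%:E)%E.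
Proof.
elim: d phi => [|d IH] phi mphi phi0.
  rewrite big_ord0 /= integral_dirac//= ?diracE ?mem_set//= ?mul1e ?big_ord0//.
  by under eq_fun do rewrite big_ord0; exact: measurable_cst.
have mP n (ps : 'I_n -> R -> R) : (forall i, measurable_fun setT (ps i)) ->
    measurable_fun setT (fun x : n.-tuple R => \prod_(i < n) ps i (tnth x i)).
  move=> mps; apply: measurable_prodr => i.
  exact: (measurableT_comp (mps i) (measurable_tnth i)).
rewrite ge0_integral_prod_lebesgueS; first last.
- by move=> x; rewrite lee_fin prodr_ge0.
- by apply/measurable_EFinP; exact: mP.
rewrite big_ord_recl -IH//.
rewrite -ge0_integralZr//=; first last.
- by apply: integral_ge0 => x _; rewrite lee_fin prodr_ge0.
- by move=> t _; rewrite lee_fin.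
- by apply/measurable_EFinP.
apply: eq_integral => t _.
rewrite -ge0_integralZl//; first last.
- by rewrite lee_fin.
- by move=> x _; rewrite lee_fin prodr_ge0.
- by apply/measurable_EFinP; exact: (mP _ (fun i => phi (lift ord0 i))).
apply: eq_integral => x _; rewrite -EFinM big_ord_recl.
by congr (_ * _)%:E; apply: eq_bigr => i _; rewrite tnthS.
Qed.

Lemma leb1_itv (a b : R) : a <= b -> leb1 `[a, b]%classic = (b - a)%:E.
Proof.
move=> ab; rewrite /leb1 /pushforward preimage_id lebesgue_measure_itv/=.
by case: ltP => // ba; rewrite (le_anti (introT andP (conj ab ba))) subrr.
Qed.

Lemma measurable_rd_box d (a b : d.-tuple R) : measurable (rd_box a b).
Proof.
rewrite (_ : rd_box a b = \bigcap_(i in [set: 'I_d])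
    ((fun x => tnth x i) @^-1` `[tnth a i, tnth b i]%classic)); last first.
  apply/seteqP; split => x /= h.
    by move=> i _ /=; rewrite in_itv/= h.
  by move=> i; have := h i I; rewrite /= in_itv.
apply: fin_bigcap_measurable => // i _.
by rewrite -[X in measurable X]setTI; apply: measurable_tnth.
Qed.

(** The indicator of a box is the product of the indicators of its sides, so the integral of a
    product of one-variable functions applies. *)
Lemma prod_lebesgue_box d (a b : d.-tuple R) :
  (forall i, tnth a i <= tnth b i) ->
  prod_lebesgue d (rd_box a b) = (rd_boxvol a b)%:E.
Proof.
move=> ab.
rewrite -[LHS]mul1e -integral_cst; last exact: measurable_rd_box.
rewrite integral_mkcond.
transitivity (\int[prod_lebesgue d]_x
    (\prod_(i < d) \1_(`[tnth a i, tnth b i]%classic) (tnth x i) : R)%:E)%E.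
  apply: eq_integral => x _; rewrite patchE.
  case: ifPn => [/set_mem xab|/negP xab].
    rewrite big1// => i _; rewrite indicE mem_set//=.
    by rewrite in_itv/= xab.
  have [i xi] : exists i, ~ (tnth a i <= tnth x i <= tnth b i).
    by apply/existsNP => h; apply: xab; rewrite inE.
  have xi' : ~ `[tnth a i, tnth b i]%classic (tnth x i) by rewrite /= in_itv.
  by rewrite (bigD1 i)//= indicE memNset ?mul0r.
rewrite (@ge0_integral_prod_lebesgue d
  (fun i => \1_(`[tnth a i, tnth b i]%classic)))//.
rewrite /rd_boxvol -prodEFin; apply: eq_bigr => i _.
rewrite integral_indic//= setIT leb1_itv//.
Qed.

End lebesgue_measures.

(** * The box-covering measure *)

(** Used to merge countably many countable box covers into a single sequence without changing the
    total volume. *)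
Lemma nneseries_nat2 (R : realType) (a : nat -> nat -> \bar R)
    (f : {bij [set: nat] >-> [set: nat * nat]}) :
  (forall i j, 0 <= a i j)%E ->
  (\sum_(0 <= k <oo) a (f k).1 (f k).2 =
   \sum_(0 <= i <oo) \sum_(0 <= j <oo) a i j)%E.
Proof.
move=> a0; rewrite nneseries_esumT//.
rewrite nneseries_esumT; last by move=> n; exact: nneseries_ge0.
under [RHS]eq_esum do rewrite nneseries_esumT//.
rewrite esum_esum//.
rewrite (_ : _ `*`` _ = [set: nat * nat]); last by apply/seteqP; split.
rewrite (reindex_esum [set: nat] _ f)//.
Qed.

Section rd_algebra.
Variables (R : realType) (d : nat).
Implicit Types x y z : d.-tuple R.

Lemma tnth_rd_sub x y i : tnth (rd_sub x y) i = tnth x i - tnth y i.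
Proof. by rewrite tnth_mktuple. Qed.

Lemma tnth_rd_zero i : tnth (rd_zero R d) i = 0.
Proof. by rewrite tnth_mktuple. Qed.

Lemma rd_subK x : involutive (rd_sub x).
Proof. by move=> y; apply: eq_from_tnth => i; rewrite !tnth_rd_sub subKr. Qed.

Lemma rd_boxvol_ge0 x y : (forall i, tnth x i <= tnth y i) -> 0 <= rd_boxvol x y.
Proof. by move=> xy; apply: prodr_ge0 => i _; rewrite subr_ge0. Qed.

Definition rd_upd x (i : 'I_d) (c : R) : d.-tuple R :=
  [tuple if j == i then c else tnth x j | j < d].

Lemma tnth_rd_upd x i c j :
  tnth (rd_upd x i c) j = if j == i then c else tnth x j.
Proof. by rewrite tnth_mktuple. Qed.

Lemma rd_boxvol_split x y i c :
  rd_boxvol x (rd_upd y i c) + rd_boxvol (rd_upd x i c) y = rd_boxvol x y.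
Proof.
rewrite /rd_boxvol (bigD1 i)//= [X in _ + X](bigD1 i)//= [RHS](bigD1 i)//=.
rewrite !tnth_rd_upd eqxx.
under eq_bigr => j /negPf ji do rewrite tnth_rd_upd ji.
under [X in _ + _ * X]eq_bigr => j /negPf ji do rewrite tnth_rd_upd ji.
by rewrite -mulrDl; congr (_ * _); rewrite addrC addrA subrK.
Qed.

End rd_algebra.

(* The dimension is a successor: for d = 0 every box has volume 1 (an empty
   product), so lebesgue_d would be constantly +oo. *)
Section lebesgue_outer.
Variables (R : realType) (d' : nat).
Let d := d'.+1.
Let L := @lebesgue_d R d.
Local Open Scope ereal_scope.

Lemma lebesgue_d_ge0 A : 0 <= L A.
Proof.
apply: le_ereal_inf_tmp => _ [ab [ab_le _] <-].
by apply: nneseries_ge0 => k _ _; rewrite lee_fin rd_boxvol_ge0.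
Qed.

Lemma lebesgue_d_box_le (a b : d.-tuple R) : (forall i, tnth a i <= tnth b i)%R ->
  L (rd_box a b) <= (rd_boxvol a b)%:E.
Proof.
move=> ab; apply: ereal_inf_lbound.
(* Covers are infinite sequences, so the box is followed by copies of the degenerate box from [a] to
   [a]; their volume is zero because the product has at least one factor. *)
exists (fun=> a, fun k => if k is 0%N then b else a) => /=.
  split; first by case.
  by move=> x abx; exists 0%N.
rewrite nneseries_recl//=; last first.
  by case=> [|k] _; rewrite lee_fin rd_boxvol_ge0.
rewrite eseries0 ?adde0// => -[|k]//= _ _.
by rewrite /rd_boxvol big_ord_recl subrr mul0r.
Qed.

Lemma le_lebesgue_d : {homo L : A B / A `<=` B >-> A <= B}.
Proof.
move=> A B AB; apply: ereal_inf_le_tmp => _ [ab [h Bab] <-].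
by exists ab => //; split => //; exact: subset_trans Bab.
Qed.

Lemma lebesgue_d0 : L set0 = 0.
Proof.
apply/eqP; rewrite eq_le lebesgue_d_ge0 andbT.
apply: (@le_trans _ _ (L (rd_box (rd_zero R d) (rd_zero R d)))).
  exact: le_lebesgue_d.
apply: (le_trans (lebesgue_d_box_le _)) => //.
by rewrite /rd_boxvol big_ord_recl subrr mul0r.
Qed.

(** Each [A n] gets a cover exceeding its infimum by at most e/2^(n+1), and the covers are merged
    along a bijection between nat and nat * nat. Sets of infinite outer measure are treated first,
    since near-optimal covers are extracted from a finite infimum. *)
Lemma lebesgue_d_sigma_subadditive : sigma_subadditive L.
Proof.
move=> A; have [[i ioo]|] := pselect (exists i, L (A i) = +oo).
  rewrite (eseries_pinfty _ _ ioo) ?leey// => n _.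
  by rewrite -ltNye (lt_le_trans _ (lebesgue_d_ge0 _)).
rewrite -forallNE => Aoo.
suff add2e (e : {posnum R}) :
    L (\bigcup_n A n) <= \sum_(i <oo) L (A i) + e%:num%:E.
  by apply/lee_addgt0Pr => _/posnumP[].
apply: le_trans (epsilon_trick xpredT (fun n => lebesgue_d_ge0 (A n)) _) => //.
pose vol (ab : (nat -> d.-tuple R) * (nat -> d.-tuple R)) k :=
  (rd_boxvol (ab.1 k) (ab.2 k))%:E.
pose P n ab := ((forall k i, tnth (ab.1 k) i <= tnth (ab.2 k) i)%R /\
    A n `<=` \bigcup_k rd_box (ab.1 k) (ab.2 k)) /\
  \sum_(0 <= k <oo) vol ab k <= L (A n) + (e%:num / (2 ^ n.+1)%:R)%:E.
have [G PG] : {G : nat -> (nat -> d.-tuple R) * (nat -> d.-tuple R) &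
    forall n, P n (G n)}.
  apply: (@choice _ _ P) => n.
  have Lfin : L (A n) \is a fin_num.
    rewrite ge0_fin_numE ?lebesgue_d_ge0//.
    by rewrite ltey; apply/eqP; exact: Aoo.
  have en1 : (0 < e%:num / (2 ^ n.+1)%:R :> R)%R by rewrite divr_gt0// ltr0n expn_gt0.
  have [_ [ab [h1 h2] <-] /ltW h3] := lb_ereal_inf_adherent en1 Lfin.
  by exists ab.
have /card_esym/ppcard_eqP[f] := card_nat2.
pose a i j := vol (G i) j.
have a0 i j : 0 <= a i j.
  by rewrite lee_fin; apply: rd_boxvol_ge0 => l; exact: (PG i).1.1.
apply: (@le_trans _ _ (\sum_(0 <= k <oo) a (f k).1 (f k).2)).
  apply: ereal_inf_lbound.
  exists (fun k => (G (f k).1).1 (f k).2, fun k => (G (f k).1).2 (f k).2) => //=.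
  split; first by move=> k i; exact: (PG (f k).1).1.1.
  move=> x [n _ Anx]; have [j _ xj] := (PG n).1.2 _ Anx.
  by exists (f^-1%FUN (n, j)) => //=; rewrite invK ?inE.
rewrite nneseries_nat2//.
apply: lee_nneseries => [i _ _|i _]; first exact: nneseries_ge0.
exact: (PG i).2.
Qed.

HB.instance Definition _ := isOuterMeasure.Build R (d.-tuple R)
  (@lebesgue_d R d'.+1)
  lebesgue_d0 lebesgue_d_ge0 le_lebesgue_d lebesgue_d_sigma_subadditive.

(* A hyperplane orthogonal to an axis cuts a box into two boxes whose volumes
   add up, so coordinate half-spaces are Caratheodory measurable. *)
Lemma caratheodory_half_space (i : 'I_d) (t : R) :
  caratheodory_measurable L [set x | t < tnth x i]%R.
Proof.
apply: (@le_caratheodory_measurable _ _ L) => X.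
apply: le_ereal_inf_tmp => _ [[a b] /= [ab_le Xab] <-].
(* The cutting level [t] is clamped to the i-th side of the k-th box: if the hyperplane misses the
   box, one of the two pieces degenerates instead of getting a negative side. *)
pose c k := Num.max (tnth (a k) i) (Num.min (tnth (b k) i) t).
have ac k : (tnth (a k) i <= c k)%R by rewrite le_max lexx.
have cb k : (c k <= tnth (b k) i)%R by rewrite ge_max ab_le ge_min lexx.
pose b' k := rd_upd (b k) i (c k).
pose a' k := rd_upd (a k) i (c k).
have ab'_le k j : (tnth (a k) j <= tnth (b' k) j)%R.
  by rewrite tnth_rd_upd; case: eqVneq => [->|_]; rewrite ?ac ?ab_le.
have a'b_le k j : (tnth (a' k) j <= tnth (b k) j)%R.
  by rewrite tnth_rd_upd; case: eqVneq => [->|_]; rewrite ?cb ?ab_le.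
rewrite (eq_eseriesr (g := fun k => (rd_boxvol (a' k) (b k))%:E +
    (rd_boxvol (a k) (b' k))%:E)); last first.
  by move=> k _; rewrite -EFinD addrC rd_boxvol_split.
rewrite nneseriesD; first last.
- by move=> k _ _; rewrite lee_fin rd_boxvol_ge0.
- by move=> k _ _; rewrite lee_fin rd_boxvol_ge0.
apply: leeD; apply: ereal_inf_lbound.
- exists (a', b) => //=; split => // x [Xx tx].
  have [k _ /= xk] := Xab _ Xx; exists k => //= j.
  have /andP[h1 h2] := xk j.
  rewrite tnth_rd_upd h2 andbT; case: eqVneq => [ji|_]//.
  by subst j; rewrite ge_max h1 ge_min (ltW tx) orbT.
- exists (a, b') => //=; split => // x [Xx /negP]; rewrite -leNgt => tx.
  have [k _ /= xk] := Xab _ Xx; exists k => //= j.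
  have /andP[h1 h2] := xk j.
  rewrite tnth_rd_upd h1/=; case: eqVneq => [ji|_]//.
  by subst j; rewrite le_max le_min h2 tx orbT.
Qed.

(** The claim is that the identity is measurable from the Caratheodory sigma-algebra to the product
    one. A map into tuples is measurable when its coordinates are, and rays generate the Borel sets
    of the line, so coordinate half-spaces suffice. *)
Lemma measurable_caratheodory (A : set (d.-tuple R)) :
  measurable A -> caratheodory_measurable L A.
Proof.
move=> mA.
pose U : measurableType _ := caratheodory_type L.
pose idU : U -> d.-tuple R := id.
suff : measurable_fun [set: U] idU.
  by move=> /(_ measurableT A mA); rewrite setTI.
apply/measurable_fun_tnthP => i.
apply: (@measurability _ _ U R setT (fun x : U => tnth (x : d.-tuple R) i) _
  (RGenOInfty.measurableE R)) => _ [_ [t ->] <-].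
rewrite setTI (_ : _ @^-1` _ = [set x | t < tnth x i]%R); last first.
  by apply/seteqP; split => x /=; rewrite in_itv/= andbT.
exact: caratheodory_half_space.
Qed.

Lemma lebesgue_d_semi_sigma_additive : semi_sigma_additive L.
Proof.
move=> F mF tF mUF.
apply: (@caratheodory_measure_sigma_additive _ _ L) => //.
- by move=> i; exact: measurable_caratheodory.
- exact: measurable_caratheodory.
Qed.

HB.instance Definition _ := isMeasure.Build _ (d.-tuple R) R (@lebesgue_d R d'.+1)
  lebesgue_d0 (fun A => lebesgue_d_ge0 A) lebesgue_d_semi_sigma_additive.

Let Q (n : nat) : set (d.-tuple R) :=
  rd_box [tuple (- n%:R)%R | _ < d] [tuple n%:R%R | _ < d].

Let le_Q (n : nat) (i : 'I_d) : (tnth [tuple (- n%:R)%R | _ < d] i <=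
  tnth [tuple n%:R%R | _ < d] i :> R)%R.
Proof. by rewrite !tnth_mktuple; apply: (@le_trans _ _ 0%R); rewrite ?oppr_le0. Qed.

Let mQ n : measurable (Q n). Proof. exact: measurable_rd_box. Qed.

Let QT : \bigcup_n Q n = setT.
Proof.
rewrite -subTset => x _.
pose M : R := (\sum_(i < d) `|tnth x i|)%R.
have [n Mn] : exists n : nat, (M <= n%:R)%R.
  by exists (Num.truncn M).+1; rewrite ltW// truncnS_gt.
exists n => // i; rewrite !tnth_mktuple -ler_norml.
apply: le_trans Mn; rewrite /M (bigD1 i)//= lerDl.
exact: sumr_ge0.
Qed.

Let ndQ : {homo Q : n m / (n <= m)%N >-> (n <= m)%O}.
Proof.
move=> n m nm; apply/subsetPset => x Qx i; have := Qx i.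
rewrite !tnth_mktuple => /andP[h1 h2]; apply/andP; split.
  by apply: le_trans h1; rewrite lerN2 ler_nat.
by apply: le_trans h2 _; rewrite ler_nat.
Qed.

Lemma lebesgue_d_sigma_finite : sigma_finite setT L.
Proof.
exists Q; first by rewrite QT.
move=> n; split => //; apply: le_lt_trans (lebesgue_d_box_le (@le_Q n)) _.
exact: ltry.
Qed.

HB.instance Definition _ := Measure_isSigmaFinite.Build _ _ _ (@lebesgue_d R d'.+1)
  lebesgue_d_sigma_finite.

Let P := prod_lebesgue R d.

(** Countable subadditivity bounds [P A] by the total volume of any box cover of [A]; the infimum
    over covers gives the claim. *)
Lemma prod_lebesgue_le (A : set (d.-tuple R)) : measurable A -> P A <= L A.
Proof.
move=> mA; apply: le_ereal_inf_tmp => _ [ab [ab_le Aab] <-].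
apply: le_trans (measure_sigma_subadditive P _ mA Aab) _ => [k|].
  exact: measurable_rd_box.
apply: lee_nneseries => [//|k _].
by rewrite -(prod_lebesgue_box (ab_le k)).
Qed.

(** One inequality is [prod_lebesgue_le]. For the other, take complements in a cube [Q n], where
    everything is finite: L(Q n) <= P(Q n) and L(Q n \ A) >= P(Q n \ A) give L(Q n & A) <= P(Q n &
    A). Continuity from below along the cubes removes the restriction. *)
Lemma lebesgue_dE (A : set (d.-tuple R)) : measurable A -> L A = P A.
Proof.
move=> mA.
have AQ n : L (A `&` Q n) = P (A `&` Q n).
  apply/eqP; rewrite eq_le prod_lebesgue_le ?andbT; last exact: measurableI.
  have PQ : P (Q n) < +oo by rewrite (prod_lebesgue_box (@le_Q n)) ltry.
  have LQ : L (Q n) < +oo.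
    by apply: le_lt_trans (lebesgue_d_box_le (@le_Q n)) (ltry _).
  rewrite ![A `&` _]setIC.
  have mQA : measurable (Q n `\` A) by exact: measurableD.
  have QA : Q n `&` (Q n `\` A) = Q n `\` A by apply/setIidr; exact: subDsetl.
  have LD : L (Q n `&` A) = L (Q n) - L (Q n `\` A).
    by have := measureD (mu := L) (mQ n) mQA LQ; rewrite setDD QA.
  have PD : P (Q n `&` A) = P (Q n) - P (Q n `\` A).
    by have := measureD (mu := P) (mQ n) mQA PQ; rewrite setDD QA.
  rewrite LD PD leeB//.
    by rewrite /P (prod_lebesgue_box (@le_Q n)); exact: lebesgue_d_box_le.
  by apply: prod_lebesgue_le; exact: measurableD.
have AE : A = \bigcup_n (A `&` Q n) by rewrite -setI_bigcupr QT setIT.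
have ndA : {homo (fun n => A `&` Q n) : n m / (n <= m)%N >-> (n <= m)%O}.
  by move=> n m nm; apply/subsetPset; apply: setIS; exact/subsetPset/ndQ.
have mAQ n : measurable (A `&` Q n) by exact: measurableI.
have mU : measurable (\bigcup_n (A `&` Q n)) by exact: bigcup_measurable.
have h1 := nondecreasing_cvg_mu (mu := L) mAQ mU ndA.
have h2 := nondecreasing_cvg_mu (mu := P) mAQ mU ndA.
rewrite -AE in h1 h2.
have E : L \o (fun n => A `&` Q n) = P \o (fun n => A `&` Q n).
  by apply/funext => n /=; exact: AQ.
rewrite E in h1; exact: cvg_unique h1 h2.
Qed.

Lemma lebesgue_d_box (a b : d.-tuple R) : (forall i, tnth a i <= tnth b i)%R ->
  L (rd_box a b) = (rd_boxvol a b)%:E.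
Proof.
by move=> ab; rewrite lebesgue_dE ?prod_lebesgue_box//; exact: measurable_rd_box.
Qed.

Lemma integral_lebesgue_dE (f : d.-tuple R -> \bar R) :
  \int[L]_x f x = \int[prod_lebesgue R d]_x f x.
Proof. by apply: eq_measure_integral => A mA _; exact: lebesgue_dE. Qed.

(** Pulling back a cover box by box gives a cover of the preimage with volumes scaled by [r]. The
    argument sees only covers, so it holds for arbitrary sets; it serves both reflections and
    dilations. *)
Lemma lebesgue_d_preimage_le (r : R) (g : d.-tuple R -> d.-tuple R) A :
  (0 < r)%R ->
  (forall a b : d.-tuple R, (forall i, tnth a i <= tnth b i)%R ->
    exists a' b' : d.-tuple R, [/\ forall i, (tnth a' i <= tnth b' i)%R,
      g @^-1` rd_box a b `<=` rd_box a' b' &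
      rd_boxvol a' b' = (r * rd_boxvol a b)%R]) ->
  L (g @^-1` A) <= r%:E * L A.
Proof.
move=> r0 H; rewrite -lee_pdivrMl//.
apply: le_ereal_inf_tmp => _ [ab [ab_le Aab] <-].
rewrite lee_pdivrMl//.
have [G PG] := choice (fun k => H _ _ (ab_le k)).
have [G' PG'] := choice PG.
rewrite -nneseriesZl; last by move=> k _; rewrite lee_fin rd_boxvol_ge0.
apply: ereal_inf_lbound; exists (G, G') => /=.
  split; first by move=> k; have [] := PG' k.
  move=> x /Aab[k _ xk]; exists k => //=.
  by have [_ + _] := PG' k; exact.
by apply: eq_eseriesr => k _; have [_ _ ->] := PG' k; rewrite EFinM.
Qed.

(** The map y |-> x - y exchanges the two corners of a box and keeps its volume, which gives one
    inequality; being an involution, it gives the other one when that inequality is applied to the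
    preimage. *)
Lemma lebesgue_d_reflect (x : d.-tuple R) A : L (rd_sub x @^-1` A) = L A.
Proof.
have le B : L (rd_sub x @^-1` B) <= L B.
  rewrite -[leRHS]mul1e; apply: lebesgue_d_preimage_le => // a b ab.
  exists (rd_sub x b), (rd_sub x a); split.
  - by move=> i; rewrite !tnth_rd_sub lerB.
  - by move=> y /= aby i; have := aby i; rewrite !tnth_rd_sub; lra.
  - by rewrite mul1r; apply: eq_bigr => i _; rewrite !tnth_rd_sub; ring.
apply/eqP; rewrite eq_le le/=.
rewrite [leLHS](_ : _ = L (rd_sub x @^-1` (rd_sub x @^-1` A))) ?le//.
by congr L; apply/seteqP; split => y /=; rewrite rd_subK.
Qed.

Lemma lebesgue_d_ball_le (r : R) : (0 < r)%R ->
  L [set x | rd_norm x <= r]%R <= (r ^+ d)%:E * L (unit_ball R d).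
Proof.
move=> r0.
pose g (x : d.-tuple R) : d.-tuple R := [tuple r^-1 * tnth x i | i < d]%R.
have gE x : rd_norm (g x) = (r^-1 * rd_norm x)%R.
  have E : rd_dot (g x) (g x) = (r^-1 ^+ 2 * rd_dot x x)%R.
    by rewrite /rd_dot mulr_sumr; apply: eq_bigr => i _; rewrite !tnth_mktuple; ring.
  by rewrite /rd_norm E sqrtrM ?sqr_ge0// sqrtr_sqr ger0_norm// invr_ge0 ltW.
have -> : [set x | rd_norm x <= r]%R = g @^-1` unit_ball R d.
  apply/seteqP; split => x /=; rewrite /unit_ball/= gE.
    by rewrite ler_pdivrMl// mulr1.
  by rewrite ler_pdivrMl// mulr1.
apply: lebesgue_d_preimage_le => [|a b ab]; first by rewrite exprn_gt0.
exists [tuple r * tnth a i | i < d]%R, [tuple r * tnth b i | i < d]%R; split.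
- by move=> i; rewrite !tnth_mktuple ler_pM2l.
- move=> x /= abx i; have := abx i; rewrite !tnth_mktuple.
  by rewrite ler_pdivlMl// ler_pdivrMl.
- transitivity (\prod_(i < d) (r * (tnth b i - tnth a i)))%R.
    by apply: eq_bigr => i _; rewrite !tnth_mktuple mulrBr.
  by rewrite big_split/= prodr_const card_ord.
Qed.

Lemma lebesgue_d_unit_ball_lty : L (unit_ball R d) < +oo.
Proof.
apply: (@le_lt_trans _ _ (L (Q 1))); last first.
  exact: le_lt_trans (lebesgue_d_box_le (@le_Q 1)) (ltry _).
apply: le_lebesgue_d => x /= xB i; rewrite !tnth_mktuple -ler_norml.
apply: le_trans xB; rewrite -sqrtr_sqr /rd_norm ler_wsqrtr//.
rewrite /rd_dot (bigD1 i)//= expr2 lerDl; apply: sumr_ge0 => j _.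
by rewrite -expr2 sqr_ge0.
Qed.

End lebesgue_outer.

(** * Poisson kernels *)

Section real_line.
Variable R : realType.
Let leb := @lebesgue_measure R.

Lemma is_derive_continuous (f df : R -> R) :
  (forall x : R, is_derive x (1 : R) f (df x)) -> continuous f.
Proof.
move=> Df x; have [dfx _] := Df x.
exact/differentiable_continuous/derivable1_diffP.
Qed.

Lemma is_derive_aff (a b x : R) : is_derive (x : R) (1 : R) (fun s => a + b * s) b.
Proof.
have H : is_derive (x : R) (1 : R) (cst a + b \*: (id : R -> R))%R (0 + b *: 1).
  exact: is_deriveD.
apply: is_derive_eq; last by rewrite add0r scaler1.
Qed.

(** Reduces integrals over the line to half-lines, where the fundamental theorem of calculus with a
    limit at infinity applies. *)
Lemma ge0_integral_fold (f : R -> R) : (forall x, 0 <= f x) -> continuous f ->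
  (\int[leb]_x (f x)%:E = \int[leb]_(x in `[0%R, +oo[) (f x)%:E +
    \int[leb]_(x in `[0%R, +oo[) (f (- x))%:E)%E.
Proof.
move=> f0 cf.
have mf : measurable_fun [set: R] f by exact: continuous_measurable_fun.
have mposnums : measurable [set x : R | 0 <= x] by rewrite -set_itvcy.
rewrite -(setUv [set x : R | 0 <= x]%R) ge0_integral_setU//= ; last 4 first.
  exact: measurableC.
  by apply/measurable_EFinP; rewrite setUv.
  by move=> x _; rewrite lee_fin.
  exact/disj_setPCl.
rewrite -set_itvcy// setCitvr.
congr +%E.
rewrite integral_itv_bndo_bndc; last exact/measurable_EFinP/measurable_funTS.
by rewrite -{1}oppr0 ge0_integration_by_substitutionNy//; exact: continuous_subspaceT.
Qed.

Section exponential.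
Variables (e : R) (e0 : 0 < e).

Let is_derive_exp x : is_derive (x : R) (1 : R) (fun s : R => expR (- (e * s)))
  (- e * expR (- (e * x))).
Proof.
have h := is_derive_aff 0 (- e) x.
have := @is_derive1_comp _ expR (fun s => 0 + - e * s) x _ _ (is_derive_expR _) h.
have -> : expR \o (fun s => 0 + - e * s) = fun s => expR (- (e * s)).
  by apply/funext => s /=; rewrite add0r mulNr.
by move=> H; apply: is_derive_eq; rewrite add0r mulNr mulrC.
Qed.

Let is_derive_cos_aff a b x : is_derive (x : R) (1 : R) (fun s : R => cos (a + b * s))
  (- b * sin (a + b * x)).
Proof.
have := @is_derive1_comp _ cos (fun s => a + b * s) x _ _ (is_derive_cos _)
  (is_derive_aff a b x).
by move=> H; apply: is_derive_eq; rewrite mulrC mulNr mulrN.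
Qed.

Let is_derive_sin_aff a b x : is_derive (x : R) (1 : R) (fun s : R => sin (a + b * s))
  (b * cos (a + b * x)).
Proof.
have := @is_derive1_comp _ sin (fun s => a + b * s) x _ _ (is_derive_sin _)
  (is_derive_aff a b x).
by move=> H; apply: is_derive_eq; rewrite mulrC.
Qed.

Let cvg_exp : (fun s : R => expR (- (e * s))) @ +oo --> (0 : R).
Proof.
apply: (@cvg_comp _ _ _ (fun s => e * s) (fun s => expR (- s)) _ +oo%R).
  exact: gt0_cvgMry.
exact: cvgr_expR.
Qed.

(* The factor 1 + cos instead of cos keeps the integrand nonnegative, which is
   what the improper FTC and, for the product measure, Tonelli require. *)
Lemma integral_exp_cos a b :
  (\int[leb]_(s in `[0%R, +oo[) (expR (- (e * s)) * (1 + cos (a + b * s)))%:E =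
   (e^-1 + (e * cos a - b * sin a) / (e ^+ 2 + b ^+ 2))%:E)%E.
Proof.
have eb0 : e ^+ 2 + b ^+ 2 != 0.
  by rewrite gt_eqF// ltr_pwDl ?exprn_gt0// sqr_ge0.
have e_neq0 : e != 0 by rewrite gt_eqF.
(* [F] is the antiderivative: -1/e belongs to the summand 1 and the quotient to the cosine. Since
   [G] is bounded, [F] tends to 0 at infinity and the integral is -F(0). *)
pose G s := - e^-1 + (b * sin (a + b * s) - e * cos (a + b * s)) / (e ^+ 2 + b ^+ 2).
pose F s := expR (- (e * s)) * G s.
have dG (x : R) : is_derive x (1 : R) G
    (b * (b * cos (a + b * x) + e * sin (a + b * x)) / (e ^+ 2 + b ^+ 2)).
  have -> : G = cst (- e^-1) + ((e ^+ 2 + b ^+ 2)^-1 \*: (b \*: (fun s => sin (a + b * s))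
      - e \*: (fun s => cos (a + b * s)))).
    by apply/funext => s; rewrite /G /= !fctE /= /cst /GRing.scale/=; ring.
  apply: is_derive_eq; rewrite /GRing.scale/=; ring.
have dF (x : R) : is_derive x (1 : R) F (expR (- (e * x)) * (1 + cos (a + b * x))).
  have -> : F = (fun s => expR (- (e * s))) * G by [].
  apply: is_derive_eq; rewrite /G /GRing.scale/=; field.
  by rewrite e_neq0 eb0.
have cF := is_derive_continuous dF.
have cf : continuous (fun s => expR (- (e * s)) * (1 + cos (a + b * s))).
  move=> x; apply: cvgM; first exact: (is_derive_continuous is_derive_exp).
  by apply: cvgD; [exact: cvg_cst|exact: (is_derive_continuous (is_derive_cos_aff a b))].
rewrite (@ge0_continuous_FTC2y _ _ F 0 0).
- rewrite -EFinB; congr EFin; rewrite /F /G !mulr0 oppr0 expR0 addr0; ring.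
- by move=> x _; rewrite mulr_ge0 ?expR_ge0// -lerBlDl sub0r cos_geN1.
- exact: continuous_subspaceT.
- pose M := e^-1 + (`|b| + e) / (e ^+ 2 + b ^+ 2).
  have GM s : `|G s| <= M.
    rewrite /G /M; apply: (le_trans (ler_normD _ _)); apply: lerD.
      by rewrite normrN ger0_norm// invr_ge0 ltW.
    rewrite normrM [X in _ * X <= _]ger0_norm; last first.
      by rewrite invr_ge0 addr_ge0 ?sqr_ge0.
    apply: ler_wpM2r; first by rewrite invr_ge0 addr_ge0 ?sqr_ge0.
    apply: (le_trans (ler_normB _ _)); rewrite !normrM (ger0_norm (ltW e0)).
    apply: lerD.
      by rewrite ler_piMr// ler_norml sin_geN1 sin_le1.
    by rewrite ler_piMr ?(ltW e0)// ler_norml cos_geN1 cos_le1.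
  apply: (@squeeze_cvgr _ _ _ _ (fun s => - M * expR (- (e * s)))
      (fun s => M * expR (- (e * s)))).
  + apply: nearW => s; rewrite mulNr -ler_norml /F normrM mulrC.
    by rewrite [`|expR _|]ger0_norm ?expR_ge0// ler_wpM2r ?expR_ge0.
  + by rewrite -[X in _ --> X](mulr0 (- M)); apply: cvgM; [exact: cvg_cst|exact: cvg_exp].
  + by rewrite -[X in _ --> X](mulr0 M); apply: cvgM; [exact: cvg_cst|exact: cvg_exp].
- by move=> x _; have [] := dF x.
- exact/cvg_at_right_filter/cF.
- by move=> x _; rewrite derive1E; exact: derive_val.
Qed.

(** The two half-lines contribute with frequencies [b] and [- b], so the sine terms cancel. The
    phase [a] is kept because it later carries the contribution of the other coordinates. *)
Lemma integral_exp_abs_cos a b :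
  (\int[leb]_s (expR (- (e * `|s|)) * (1 + cos (a + b * s)))%:E =
   (2 / e + cos a * (2 * e / (e ^+ 2 + b ^+ 2)))%:E)%E.
Proof.
rewrite ge0_integral_fold; first last.
- move=> x; apply: cvgM.
    apply: (@continuous_comp _ _ _ (fun s : R => `|s|) (fun s => expR (- (e * s)))).
      exact: norm_continuous.
    exact: (is_derive_continuous is_derive_exp).
  by apply: cvgD; [exact: cvg_cst|exact: (is_derive_continuous (is_derive_cos_aff a b))].
- by move=> x; rewrite mulr_ge0 ?expR_ge0// -lerBlDl sub0r cos_geN1.
transitivity (\int[leb]_(s in `[0%R, +oo[) (expR (- (e * s)) * (1 + cos (a + b * s)))%:E +
  \int[leb]_(s in `[0%R, +oo[) (expR (- (e * s)) * (1 + cos (a + - b * s)))%:E)%E.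
  congr (_ + _)%E; apply: eq_integral => s; rewrite inE/= in_itv/= andbT => s0.
    by rewrite ger0_norm.
  by rewrite normrN ger0_norm// mulrN mulNr.
rewrite !integral_exp_cos -EFinD; congr EFin; rewrite sqrrN; ring.
Qed.

(** The Fourier transform of exp(-e|s|), that is, the Poisson kernel of the half-plane at height
    e/(2 pi). *)
Definition poisson_kernel z := 2 * e / (e ^+ 2 + (2 * pi * z) ^+ 2).

Let den_gt0 z : 0 < e ^+ 2 + (2 * pi * z) ^+ 2.
Proof. by rewrite ltr_pwDl ?exprn_gt0// sqr_ge0. Qed.

Lemma poisson_kernel_ge0 z : 0 <= poisson_kernel z.
Proof. by rewrite divr_ge0 ?mulr_ge0 ?(ltW e0) ?(ltW (den_gt0 z)). Qed.

Lemma poisson_kernel_le z : poisson_kernel z <= 2 / e.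
Proof.
rewrite ler_pdivrMr// mulrDr.
have -> : 2 / e * e ^+ 2 = 2 * e by field; rewrite gt_eqF.
by rewrite lerDl mulr_ge0 ?sqr_ge0// divr_ge0 ?(ltW e0).
Qed.

Lemma continuous_poisson_kernel : continuous poisson_kernel.
Proof.
move=> z; apply: cvgM; first exact: cvg_cst.
apply: cvgV; first by rewrite gt_eqF.
apply: cvgD; first exact: cvg_cst.
apply: (@continuous_comp _ _ _ (fun z => 2 * pi * z) (fun x => x ^+ 2)).
  by apply: cvgMl_tmp; exact: cvg_id.
exact: exprn_continuous.
Qed.

Lemma integral_poisson_kernel : (\int[leb]_z (poisson_kernel z)%:E = 1)%E.
Proof.
rewrite ge0_integral_fold; first last.
- exact: continuous_poisson_kernel.
- exact: poisson_kernel_ge0.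
rewrite [X in (_ + X)%E](_ : _ =
    \int[leb]_(x in `[0%R, +oo[) (poisson_kernel x)%:E)%E; last first.
  by apply: eq_integral => x _; rewrite /poisson_kernel mulrN sqrrN.
suff -> : (\int[leb]_(x in `[0%R, +oo[) (poisson_kernel x)%:E = (2^-1)%:E)%E.
  by rewrite -EFinD; congr EFin; field.
have pi0 : pi != 0 :> R by rewrite gt_eqF// pi_gt0.
have e_neq0 : e != 0 by rewrite gt_eqF.
(* Antiderivative of the kernel; it runs from 0 to 1/2 on the half-line, and evenness doubles this
   to total mass 1. *)
pose F z := pi^-1 * atan (0 + 2 * pi / e * z).
have dF (x : R) : is_derive x (1 : R) F (poisson_kernel x).
  have := @is_derive1_comp _ atan (fun s => 0 + 2 * pi / e * s) x _ _
    (is_derive1_atan _) (is_derive_aff 0 (2 * pi / e) x).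
  move=> H.
  have -> : F = pi^-1 \*: (atan \o (fun s => 0 + 2 * pi / e * s)) by [].
  apply: is_derive_eq; rewrite /poisson_kernel /GRing.scale/=.
  move: pi0 (den_gt0 x); generalize (@pi R) => p p0 d0; field.
  by rewrite p0 e_neq0 gt_eqF.
have cF := is_derive_continuous dF.
rewrite (@ge0_continuous_FTC2y _ _ F 0 2^-1).
- by rewrite /F mulr0 addr0 atan0 mulr0 sube0.
- by move=> x _; exact: poisson_kernel_ge0.
- by apply: continuous_subspaceT; exact: continuous_poisson_kernel.
- have -> : 2^-1 = pi^-1 * (pi / 2) :> R by rewrite mulrA mulVf// mul1r.
  apply: cvgMl_tmp.
  apply: (@cvg_comp _ _ _ (fun s => 0 + 2 * pi / e * s) atan _ +oo%R).
    under eq_fun do rewrite add0r.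
    have p0 : 0 < 2 * pi / e by rewrite divr_gt0// mulr_gt0// pi_gt0.
    exact: (gt0_cvgMry p0 cvg_id).
  exact: cvgy_atan.
- by move=> x _; have [] := dF x.
- exact/cvg_at_right_filter/cF.
- by move=> x _; rewrite derive1E; exact: derive_val.
Qed.

End exponential.

(** With Z = (2 pi z)^2 and D = (2 pi delta)^2 <= Z, the ratio of the two kernels is e(1+Z)/(e^2+Z)
    <= e(1+Z)/Z <= e(1+D)/D. Comparison with the kernel at parameter 1 keeps the bound integrable
    with known mass. *)
Lemma poisson_kernel_tail (e delta z : R) : 0 < e -> 0 < delta -> delta <= `|z| ->
  poisson_kernel e z <=
  e * ((1 + (2 * pi * delta) ^+ 2) / (2 * pi * delta) ^+ 2) * poisson_kernel 1 z.
Proof.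
move=> e0 delta0 dz; rewrite /poisson_kernel expr1n mulr1.
have pi0 : 0 < pi :> R := pi_gt0 R.
set D := (2 * pi * delta) ^+ 2; set Z := (2 * pi * z) ^+ 2.
have D0 : 0 < D by rewrite exprn_gt0// mulr_gt0// mulr_gt0.
have DZ : D <= Z.
  rewrite /D /Z -[leRHS]real_normK ?num_real// ler_pXn2r ?nnegrE ?mulr_ge0 ?(ltW pi0) ?(ltW delta0)//.
  by rewrite normrM ger0_norm ?mulr_ge0 ?(ltW pi0)// ler_wpM2l// mulr_ge0// ltW.
have Z0 : 0 < Z by apply: lt_le_trans DZ.
have e20 : 0 < e ^+ 2 by rewrite exprn_gt0.
rewrite ler_pdivrMr; last by rewrite addr_gt0.
have -> : e * ((1 + D) / D) * (2 / (1 + Z)) * (e ^+ 2 + Z) =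
  2 * e * (((1 + D) * (e ^+ 2 + Z)) / (D * (1 + Z))).
  by field; rewrite !gt_eqF//; lra.
rewrite ler_peMr ?mulr_ge0 ?(ltW e0)//.
rewrite ler_pdivlMr ?mul1r; last by rewrite mulr_gt0//; lra.
nra.
Qed.

End real_line.

(** * Product weights and product Poisson kernels in R^d *)

Section poisson_rd.
Variable R : realType.

Lemma measurable_cos_fun d (T : measurableType d) (g : T -> R) :
  measurable_fun setT g -> measurable_fun setT (fun x => cos (g x)).
Proof.
move=> mg.
exact: (measurableT_comp (continuous_measurable_fun (@continuous_cos R)) mg).
Qed.

Lemma measurable_sin_fun d (T : measurableType d) (g : T -> R) :
  measurable_fun setT g -> measurable_fun setT (fun x => sin (g x)).
Proof.
move=> mg.
exact: (measurableT_comp (continuous_measurable_fun (@continuous_sin R)) mg).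
Qed.

Lemma rd_dot_cons d (t s : R) (x y : d.-tuple R) :
  rd_dot (cons_rd (t, x)) (cons_rd (s, y)) = t * s + rd_dot x y.
Proof.
rewrite /rd_dot big_ord_recl; congr (_ + _).
by apply: eq_bigr => i _; rewrite !tnthS.
Qed.

Lemma measurable_rd_dot d (x : d.-tuple R) :
  measurable_fun [set: d.-tuple R] (rd_dot x).
Proof.
apply: measurable_sum => i; apply: measurable_funM => //.
exact: measurable_tnth.
Qed.

Definition exp_weight (e : R) d (x : d.-tuple R) : R :=
  \prod_(i < d) expR (- (e * `|tnth x i|)).

Definition poisson_rd (e : R) d (z : d.-tuple R) : R :=
  \prod_(i < d) poisson_kernel e (tnth z i).

Lemma exp_weight_ge0 e d (x : d.-tuple R) : 0 <= exp_weight e x.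
Proof. by apply: prodr_ge0 => i _; exact: expR_ge0. Qed.

Lemma measurable_exp_abs (e : R) : measurable_fun [set: R] (fun s => expR (- (e * `|s|))).
Proof.
have h : measurable_fun [set: R] (fun s : R => - (e * `|s|)).
  by apply: measurable_funN; apply: measurable_funM => //; exact: normr_measurable.
exact: (measurableT_comp (continuous_measurable_fun (@continuous_expR R)) h).
Qed.

Lemma measurable_exp_weight e d : measurable_fun [set: d.-tuple R] (@exp_weight e d).
Proof.
apply: measurable_prodr => i.
exact: (measurableT_comp (measurable_exp_abs e) (measurable_tnth i)).
Qed.

Lemma measurable_poisson_kernel (e : R) : 0 < e ->
  measurable_fun [set: R] (poisson_kernel e).
Proof.
by move=> e0; apply: continuous_measurable_fun; exact: continuous_poisson_kernel.
Qed.

Lemma measurable_cos_dot d (c k : R) (x : d.-tuple R) :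
  measurable_fun [set: d.-tuple R] (fun y => cos (c + k * rd_dot x y)).
Proof.
apply: measurable_cos_fun.
apply: measurable_funD => //; apply: measurable_funM => //.
exact: measurable_rd_dot.
Qed.

Section positive.
Variables (e : R) (e0 : 0 < e).

Lemma poisson_rd_ge0 d (z : d.-tuple R) : 0 <= poisson_rd e z.
Proof. by apply: prodr_ge0 => i _; exact: poisson_kernel_ge0. Qed.

Lemma poisson_rd_le d (z : d.-tuple R) : poisson_rd e z <= (2 / e) ^+ d.
Proof.
rewrite -[d in _ ^+ d]card_ord -prodr_const; apply: ler_prod => i _.
by rewrite poisson_kernel_ge0//= poisson_kernel_le.
Qed.

Lemma measurable_poisson_rd d : measurable_fun [set: d.-tuple R] (@poisson_rd e d).
Proof.
apply: measurable_prodr => i.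
exact: (measurableT_comp (measurable_poisson_kernel e0) (measurable_tnth i)).
Qed.

Lemma integral_leb1_exp_abs_cos (a b : R) :
  (\int[@leb1 R]_s (expR (- (e * `|s|)) * (1 + cos (a + b * s)))%:E =
   (2 / e + cos a * (2 * e / (e ^+ 2 + b ^+ 2)))%:E)%E.
Proof.
rewrite ge0_integral_leb1 ?integral_exp_abs_cos//.
- apply/measurable_EFinP; apply: measurable_funM; first exact: measurable_exp_abs.
  apply: measurable_funD => //.
  apply: measurable_cos_fun.
  by apply: measurable_funD => //; apply: measurable_funM.
Qed.

Lemma integral_leb1_exp_abs :
  (\int[@leb1 R]_s (expR (- (e * `|s|)))%:E = (2 / e)%:E)%E.
Proof.
have h2 : ((2%:E * \int[@leb1 R]_s (expR (- (e * `|s|)))%:E) =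
  (2%:E * (2 / e)%:E))%E.
  rewrite -ge0_integralZl//.
  - transitivity (\int[@leb1 R]_s
        (expR (- (e * `|s|)) * (1 + cos (0 + 0 * s)))%:E)%E.
      by apply: eq_integral => s _; rewrite -EFinM mul0r addr0 cos0 mulrC.
    rewrite integral_leb1_exp_abs_cos -EFinM cos0; congr EFin; field.
    by rewrite gt_eqF.
  - by apply/measurable_EFinP; exact: measurable_exp_abs.
have := congr1 (fun u => (2^-1)%:E * u)%E h2.
by rewrite !muleA -EFinM mulVf// !mul1e.
Qed.

(** Induction on the dimension with the phase [a] general: after splitting off the first coordinate
    [s], the term 2 pi t s of the scalar product joins the phase of the inner integral. *)
Lemma integral_exp_weight_cos d (a : R) (z : d.-tuple R) :
  (\int[prod_lebesgue R d]_x
     (exp_weight e x * (1 + cos (a + 2 * pi * rd_dot z x)))%:E =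
   ((2 / e) ^+ d + cos a * poisson_rd e z)%:E)%E.
Proof.
have mf n (c : R) (y : n.-tuple R) : measurable_fun [set: n.-tuple R]
    (fun x => exp_weight e x * (1 + cos (c + 2 * pi * rd_dot y x))).
  apply: measurable_funM; first exact: measurable_exp_weight.
  by apply: measurable_funD => //; exact: measurable_cos_dot.
have f0 n (c : R) (y : n.-tuple R) x :
    0 <= exp_weight e x * (1 + cos (c + 2 * pi * rd_dot y x)).
  by rewrite mulr_ge0 ?exp_weight_ge0// -lerBlDl sub0r cos_geN1.
elim: d z a => [|d IH] z a.
  rewrite /= integral_dirac//=; last by apply/measurable_EFinP; exact: mf.
  rewrite diracT mul1e /exp_weight /poisson_rd /rd_dot !big_ord0.
  by rewrite expr0 mulr0 addr0 mul1r mulr1.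
rewrite -(uncons_rdK z); case: (uncons_rd z) => t z' {z}.
rewrite ge0_integral_prod_lebesgueS; first last.
- by move=> x; rewrite lee_fin.
- by apply/measurable_EFinP; exact: mf.
(* Rewrites (2/e)^d + P cos as A + P (1 + cos), with P the kernel at z'. Both summands are
   nonnegative because P <= (2/e)^d, so the outer integral can be split. *)
pose A := (2 / e) ^+ d - poisson_rd e z'.
have A0 : 0 <= A by rewrite subr_ge0 poisson_rd_le.
have C0 := poisson_rd_ge0 z'.
transitivity (\int[@leb1 R]_s (A%:E * (expR (- (e * `|s|)))%:E +
    (poisson_rd e z')%:E *
    (expR (- (e * `|s|)) * (1 + cos (a + 2 * pi * t * s)))%:E))%E.
  apply: eq_integral => s _.
  transitivity (\int[prod_lebesgue R d]_x ((expR (- (e * `|s|)))%:E *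
      (exp_weight e x * (1 + cos (a + 2 * pi * t * s + 2 * pi * rd_dot z' x)))%:E))%E.
    apply: eq_integral => x _; rewrite -EFinM; congr EFin.
    rewrite rd_dot_cons /exp_weight big_ord_recl mulrA.
    congr (_ * _ * (1 + cos _)).
      by apply: eq_bigr => i _; rewrite tnthS.
    by rewrite mulrDr addrA !mulrA.
  rewrite ge0_integralZl//; last 2 first.
  - by apply/measurable_EFinP; exact: mf.
  - by move=> x _; rewrite lee_fin.
  rewrite IH -!EFinM -EFinD; congr EFin; rewrite /A; ring.
have cos1 x : 0 <= 1 + cos x :> R by rewrite -lerBlDl sub0r cos_geN1.
have mexp : measurable_fun [set: R] (fun s => (expR (- (e * `|s|)))%:E).
  by apply/measurable_EFinP; exact: measurable_exp_abs.
have mexpc : measurable_fun [set: R] (fun s =>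
    (expR (- (e * `|s|)) * (1 + cos (a + 2 * pi * t * s)))%:E).
  apply/measurable_EFinP; apply: measurable_funM; first exact: measurable_exp_abs.
  apply: measurable_funD => //; apply: measurable_cos_fun.
  by apply: measurable_funD => //; apply: measurable_funM.
have exp0 s : (0 <= (expR (- (e * `|s|)))%:E)%E by rewrite lee_fin expR_ge0.
have expc0 s : (0 <= (expR (- (e * `|s|)) * (1 + cos (a + 2 * pi * t * s)))%:E)%E.
  by rewrite lee_fin mulr_ge0// expR_ge0.
rewrite ge0_integralD//; first last.
- exact: measurable_funeM.
- by move=> s _; apply: mule_ge0; rewrite ?lee_fin.
- exact: measurable_funeM.
- by move=> s _; apply: mule_ge0; rewrite ?lee_fin.
rewrite ge0_integralZl// ge0_integralZl//.
rewrite integral_leb1_exp_abs integral_leb1_exp_abs_cos.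
rewrite -!EFinM -EFinD; congr EFin.
have -> : poisson_rd e (cons_rd (t, z')) = poisson_kernel e t * poisson_rd e z'.
  rewrite /poisson_rd big_ord_recl; congr (_ * _).
  by apply: eq_bigr => i _; rewrite tnthS.
rewrite /poisson_kernel /A [(2 / e) ^+ d.+1]exprS; ring.
Qed.

Lemma integral_exp_weight d :
  (\int[prod_lebesgue R d]_x (exp_weight e x)%:E = ((2 / e) ^+ d)%:E)%E.
Proof.
rewrite (@ge0_integral_prod_lebesgue _ d (fun _ s => expR (- (e * `|s|)))).
- by rewrite integral_leb1_exp_abs prodEFin prodr_const card_ord.
- by move=> _; exact: measurable_exp_abs.
- by move=> _ s; exact: expR_ge0.
Qed.

Lemma integral_leb1_poisson_kernel :
  (\int[@leb1 R]_z (poisson_kernel e z)%:E = 1)%E.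
Proof.
rewrite ge0_integral_leb1 ?integral_poisson_kernel//.
- by apply/measurable_EFinP; exact: measurable_poisson_kernel.
- by move=> x; rewrite lee_fin poisson_kernel_ge0.
Qed.

Lemma integral_poisson_rd d :
  (\int[prod_lebesgue R d]_x (poisson_rd e x)%:E = 1)%E.
Proof.
rewrite (@ge0_integral_prod_lebesgue _ d (fun _ => poisson_kernel e)).
- by rewrite big1// => i _; rewrite integral_leb1_poisson_kernel.
- by move=> _; exact: measurable_poisson_kernel.
- by move=> _ s; exact: poisson_kernel_ge0.
Qed.

End positive.

(** The indicator affects only the i-th factor; the others integrate to 1, and the i-th one is
    bounded by the one-dimensional tail estimate. *)
Lemma integral_poisson_rd_tail (e delta : R) d (i : 'I_d) : 0 < e -> 0 < delta ->
  (\int[prod_lebesgue R d]_x (poisson_rd e x * \1_([set s : R | (delta <= `|s|)%R]) (tnth x i))%:E <=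
   (e * ((1 + (2 * pi * delta) ^+ 2) / (2 * pi * delta) ^+ 2))%:E)%E.
Proof.
move=> e0 delta0.
set K := (1 + _) / _.
have K0 : 0 <= K by rewrite divr_ge0 ?addr_ge0 ?sqr_ge0.
have mI : measurable_fun [set: R] (\1_([set s : R | delta <= `|s|]) : R -> R).
  apply: measurable_indic.
  rewrite -[X in measurable X]setTI.
  rewrite (_ : [set _ | _] = (fun s : R => `|s|) @^-1` `[delta, +oo[%classic); last first.
    by apply/seteqP; split => s /=; rewrite in_itv/= andbT.
  exact: (@normr_measurable R setT).
pose phi (j : 'I_d) s := poisson_kernel e s * (if j == i then \1_([set s : R | delta <= `|s|]) s else 1).
rewrite (_ : (\int[_]_x _)%E =
    (\int[prod_lebesgue R d]_x (\prod_(j < d) phi j (tnth x j))%:E)%E); last first.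
  apply: eq_integral => x _.
  congr EFin; rewrite /phi big_split/=; congr (_ * _).
  by rewrite (bigD1 i)//= eqxx big1 ?mulr1// => j /negPf ->.
rewrite ge0_integral_prod_lebesgue; first last.
- by move=> j s; rewrite mulr_ge0 ?poisson_kernel_ge0//; case: ifP.
- move=> j; apply: measurable_funM; first exact: measurable_poisson_kernel.
  by case: eqP.
rewrite (bigD1 i)//= big1 ?mule1; last first.
  move=> j /negPf ji; rewrite -[RHS](integral_leb1_poisson_kernel e0).
  by apply: eq_integral => s _; rewrite /phi ji mulr1.
apply: (@le_trans _ _ (\int[@leb1 R]_s ((e * K)%:E * (poisson_kernel 1 s)%:E))%E).
  apply: ge0_le_integral => //.
  - move=> s _; rewrite lee_fin /phi eqxx mulr_ge0 ?poisson_kernel_ge0//.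
  - apply/measurable_EFinP; rewrite /phi eqxx.
    by apply: measurable_funM => //; exact: measurable_poisson_kernel.
  - apply/measurable_EFinP; apply: measurable_funM => //.
    exact: measurable_poisson_kernel.
  - move=> s _; rewrite -EFinM lee_fin /phi eqxx.
    rewrite indicE; case: (boolP (s \in _)) => [/set_mem ds|_].
      by rewrite mulr1; exact: poisson_kernel_tail.
    have h1 : 0 <= poisson_kernel 1 s by exact: poisson_kernel_ge0.
    by rewrite mulr0 mulr_ge0 // mulr_ge0 // ltW.
rewrite ge0_integralZl//.
- by rewrite integral_leb1_poisson_kernel// mule1.
- by apply/measurable_EFinP; exact: measurable_poisson_kernel.
- by move=> s _; rewrite lee_fin poisson_kernel_ge0.
- by rewrite lee_fin mulr_ge0// ltW.
Qed.

End poisson_rd.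

(** * Convolutions and their Fourier transforms *)

Section rd_integrals.
Variables (R : realType) (d' : nat).
Let d := d'.+1.
Local Notation T := (d.-tuple R).
Let L : {sigma_finite_measure set T -> \bar R} := @lebesgue_d R d'.+1.
Local Notation J := (@rd_integral R d'.+1).
Implicit Types (f g u v : T -> R) (x y : T).

Definition rd_int (f : T -> R) : Prop := L.-integrable setT (EFin \o f).

Lemma rd_int_measurable f : rd_int f -> measurable_fun [set: T] f.
Proof. by move=> /integrableP[/measurable_EFinP]. Qed.

Lemma rd_integrableP f : rd_integrable f <-> rd_int f.
Proof.
split=> [[mf foo]|/integrableP[/measurable_EFinP mf foo]].
  by apply/integrableP; split => //; exact/measurable_EFinP.
by split.
Qed.

Lemma EFin_rd_integral f : rd_int f -> (J f)%:E = (\int[L]_x (f x)%:E)%E.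
Proof. by move=> If; rewrite /rd_integral fineK//; exact: integrable_fin_num. Qed.

Lemma eq_rd_int f g : f =1 g -> rd_int f -> rd_int g.
Proof. by move=> /funext ->. Qed.

Lemma rd_int_le f g : measurable_fun [set: T] f ->
  (forall x, `|f x| <= g x) -> rd_int g -> rd_int f.
Proof.
move=> mf fg; apply: le_integrable => //; first exact/measurable_EFinP.
by move=> x _ /=; rewrite lee_fin (le_trans (fg x))// ler_norm.
Qed.

Lemma rd_int_ge0 f (B : R) : measurable_fun [set: T] f -> (forall x, 0 <= f x) ->
  (\int[L]_x (f x)%:E <= B%:E)%E -> rd_int f /\ J f <= B.
Proof.
move=> mf f0 fB.
have If : rd_int f.
  apply/integrableP; split; first exact/measurable_EFinP.
  apply: (@le_lt_trans _ _ B%:E); last exact: ltry.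
  apply: le_trans fB; rewrite le_eqVlt; apply/orP; left; apply/eqP.
  by apply: eq_integral => x _ /=; rewrite ger0_norm.
by split => //; rewrite -lee_fin EFin_rd_integral.
Qed.

Lemma rd_intD f g : rd_int f -> rd_int g -> rd_int (fun x => f x + g x).
Proof. by move=> If Ig; exact: (integrableD measurableT If Ig). Qed.

Lemma rd_intB f g : rd_int f -> rd_int g -> rd_int (fun x => f x - g x).
Proof. by move=> If Ig; exact: (integrableB measurableT If Ig). Qed.

Lemma rd_intZ r f : rd_int f -> rd_int (fun x => r * f x).
Proof. by move=> If; exact: (integrableZl measurableT r If). Qed.

Lemma rd_int_norm f : rd_int f -> rd_int (fun x => `|f x|).
Proof. by move=> If; exact: integrable_norm. Qed.

Lemma rd_intM f u K : rd_int f -> measurable_fun [set: T] u ->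
  (forall x, `|u x| <= K) -> rd_int (fun x => f x * u x).
Proof.
move=> If mu uK; apply: (@rd_int_le _ (fun x => K * `|f x|)).
- by apply: measurable_funM => //; exact: rd_int_measurable.
- by move=> x; rewrite normrM mulrC ler_wpM2r.
- exact/rd_intZ/rd_int_norm.
Qed.

Lemma rd_integralD f g : rd_int f -> rd_int g ->
  J (fun x => f x + g x) = J f + J g.
Proof. by move=> If Ig; exact: (@RintegralD _ _ _ L). Qed.

Lemma rd_integralB f g : rd_int f -> rd_int g ->
  J (fun x => f x - g x) = J f - J g.
Proof. by move=> If Ig; exact: (@RintegralB _ _ _ L). Qed.

Lemma rd_integralZ r f : rd_int f -> J (fun x => r * f x) = r * J f.
Proof. by move=> If; exact: (@RintegralZl _ _ _ L). Qed.

Lemma rd_integralZr r f : rd_int f -> J (fun x => f x * r) = J f * r.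
Proof. by move=> If; exact: (@RintegralZr _ _ _ L). Qed.

Lemma le_rd_integral f g : rd_int f -> rd_int g -> (forall x, f x <= g x) ->
  J f <= J g.
Proof. by move=> If Ig fg; apply: (@le_Rintegral _ _ _ L). Qed.

Lemma rd_integral_ge0 f : (forall x, 0 <= f x) -> 0 <= J f.
Proof. by move=> f0; apply: (@Rintegral_ge0 _ _ _ L). Qed.

Lemma le_norm_rd_integral f : rd_int f -> `|J f| <= J (fun x => `|f x|).
Proof. by move=> If; apply: (@le_normr_Rintegral _ _ _ L). Qed.

Lemma eq_rd_integral f g : f =1 g -> J f = J g.
Proof. by move=> /funext ->. Qed.

(** The quadratic polynomial in t given by the integral of (t u - v)^2 is nonnegative; evaluate it
    at its minimum t = P/U. *)
Lemma rd_cauchy_schwarz u v : measurable_fun [set: T] u -> measurable_fun [set: T] v ->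
  rd_int (fun x => u x ^+ 2) -> rd_int (fun x => v x ^+ 2) ->
  J (fun x => u x * v x) ^+ 2 <= J (fun x => u x ^+ 2) * J (fun x => v x ^+ 2).
Proof.
move=> mu mv Iu Iv.
have Iuv : rd_int (fun x => u x * v x).
  apply: (rd_int_le _ _ (rd_intD Iu Iv)); first exact: measurable_funM.
  move=> x; rewrite ler_norml; have := sqr_ge0 (u x + v x).
  have := sqr_ge0 (u x - v x); have := sqr_ge0 (u x); have := sqr_ge0 (v x).
  by rewrite !expr2 => *; apply/andP; split; nra.
set U := J (fun x => u x ^+ 2); set V := J (fun x => v x ^+ 2).
set P := J _.
have U0 : 0 <= U by apply: rd_integral_ge0 => x; exact: sqr_ge0.
have V0 : 0 <= V by apply: rd_integral_ge0 => x; exact: sqr_ge0.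
have H t : 0 <= t ^+ 2 * U - t * 2 * P + V.
  rewrite -rd_integralZ// -rd_integralZ// -rd_integralB; last 2 first.
  - exact: rd_intZ.
  - exact: rd_intZ.
  rewrite -rd_integralD//; last by apply: rd_intB; exact: rd_intZ.
  apply: rd_integral_ge0 => x; have := sqr_ge0 (t * u x - v x).
  by rewrite !expr2; nra.
have [U00|U1] := eqVneq U 0.
  have P0 : P = 0.
    apply/eqP; apply: contraT => P0.
    (* If U = 0 the polynomial is affine in t; at this t it would equal -1 unless P = 0. *)
    have := H ((V + 1) / (2 * P)); rewrite U00 mulr0 sub0r.
    have -> : (V + 1) / (2 * P) * 2 * P = V + 1 by field.
    lra.
  by rewrite P0 U00 expr0n mul0r.
have Upos : 0 < U by rewrite lt_def U1.
have := H (P / U).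
have -> : (P / U) ^+ 2 * U - P / U * 2 * P + V = (U * V - P ^+ 2) / U by field.
by rewrite ler_pdivlMr// mul0r subr_ge0.
Qed.

Lemma measurable_rd_sub_fun d1 (S : measurableType d1) (p q : S -> T) :
  measurable_fun [set: S] p -> measurable_fun [set: S] q ->
  measurable_fun [set: S] (fun z => rd_sub (p z) (q z)).
Proof.
move=> mp mq; apply/measurable_fun_tnthP => i.
rewrite (_ : _ \o _ = fun z => tnth (p z) i - tnth (q z) i); last first.
  by apply/funext => z /=; rewrite tnth_rd_sub.
apply: measurable_funB.
  exact: (measurableT_comp (measurable_tnth i) mp).
exact: (measurableT_comp (measurable_tnth i) mq).
Qed.

Lemma measurable_rd_sub x : measurable_fun [set: T] (rd_sub x).
Proof. exact: measurable_rd_sub_fun. Qed.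

Lemma measurable_rd_dot_fun d1 (S : measurableType d1) (p q : S -> T) :
  measurable_fun [set: S] p -> measurable_fun [set: S] q ->
  measurable_fun [set: S] (fun z => rd_dot (p z) (q z)).
Proof.
move=> mp mq; apply: measurable_sum => i; apply: measurable_funM.
  exact: (measurableT_comp (measurable_tnth i) mp).
exact: (measurableT_comp (measurable_tnth i) mq).
Qed.

Lemma ge0_integral_reflect x (F : T -> \bar R) : measurable_fun [set: T] F ->
  (forall y, 0 <= F y)%E ->
  (\int[L]_y F (rd_sub x y) = \int[L]_y F y)%E.
Proof.
move=> mF F0; have mg := measurable_rd_sub x.
rewrite -[LHS](ge0_integral_pushforward mg L measurableT)//; last first.
pose m' : {measure set T -> \bar R} :=
  measure_function_pushforward__canonical__measure_function_Measure L mg.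
rewrite [LHS](_ : _ = \int[m']_y F y)%E//.
apply: eq_measure_integral => A mA _.
exact: lebesgue_d_reflect.
Qed.

Lemma integral_reflect x (F : T -> \bar R) : measurable_fun [set: T] F ->
  (\int[L]_y F (rd_sub x y) = \int[L]_y F y)%E.
Proof.
move=> mF; rewrite integralE [RHS]integralE.
rewrite -[fun y => F (rd_sub x y)]/(F \o rd_sub x) funepos_comp funeneg_comp.
congr (_ - _)%E.
  by apply: (ge0_integral_reflect x (measurable_funepos mF)) => y; exact: funepos_ge0.
by apply: (ge0_integral_reflect x (measurable_funeneg mF)) => y; exact: funeneg_ge0.
Qed.

Lemma rd_sub_subr x y : rd_sub (rd_zero R d) (rd_sub y x) = rd_sub x y.
Proof.
by apply: eq_from_tnth => i; rewrite !tnth_rd_sub tnth_rd_zero sub0r opprB.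
Qed.

(** A translation is the composition of two reflections: x - y = 0 - (y - x). *)
Lemma integral_translate y (F : T -> \bar R) : measurable_fun [set: T] F ->
  (\int[L]_x F (rd_sub x y) = \int[L]_x F x)%E.
Proof.
move=> mF; rewrite -(integral_reflect (rd_zero R d) mF).
rewrite -[RHS](integral_reflect y); last first.
  exact: (measurableT_comp mF (measurable_rd_sub (rd_zero R d))).
by apply: eq_integral => x _; rewrite rd_sub_subr.
Qed.

Lemma rd_integral_reflect x f : measurable_fun [set: T] f ->
  J (fun y => f (rd_sub x y)) = J f.
Proof.
move=> mf; congr fine.
by apply: (@integral_reflect x (EFin \o f)); exact/measurable_EFinP.
Qed.

Lemma rd_int_reflect x f : rd_int f -> rd_int (fun y => f (rd_sub x y)).
Proof.
move=> If; have mf := rd_int_measurable If.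
apply/integrableP; split.
  apply/measurable_EFinP; exact: (measurableT_comp mf (measurable_rd_sub x)).
have /integrableP[_] := If; apply: le_lt_trans.
rewrite le_eqVlt; apply/orP; left; apply/eqP.
apply: (@integral_reflect x (fun y => `|(f y)%:E|%E)).
by apply: measurableT_comp => //; exact/measurable_EFinP.
Qed.

Section convolution.
Variables (h k : T -> R) (K : R).
Hypotheses (Ih : rd_int h) (Ik : rd_int k) (kK : forall x, `|k x| <= K).

Let mh := rd_int_measurable Ih.
Let mk := rd_int_measurable Ik.

Let mk2 : measurable_fun [set: T * T] (fun z : T * T => k (rd_sub z.1 z.2)).
Proof. exact: (measurableT_comp mk (measurable_rd_sub_fun measurable_fst measurable_snd)). Qed.

Let mh2 : measurable_fun [set: T * T] (fun z : T * T => h z.2).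
Proof. exact: (measurableT_comp mh measurable_snd). Qed.

Lemma rd_int_convol_section x : rd_int (fun y => h y * k (rd_sub x y)).
Proof.
apply: (rd_intM (K := K)) => //.
exact: (measurableT_comp mk (measurable_rd_sub x)).
Qed.

(** Integrating in [x] first, translation invariance bounds the double integral by U ||h||_1
    ||k||_1. The bounded test function [u] lets one application of Fubini serve for the constant 1,
    cosines and sines. *)
Lemma integrable_convol2 (u : T -> R) (U : R) : measurable_fun [set: T] u ->
  (forall x, `|u x| <= U) ->
  (L \x L)%E.-integrable setT
    (fun z : T * T => (h z.2 * k (rd_sub z.1 z.2) * u z.1)%:E).
Proof.
move=> mu uU.
have mG : measurable_fun [set: T * T]
    (fun z : T * T => (h z.2 * k (rd_sub z.1 z.2) * u z.1)%:E).
  apply/measurable_EFinP; apply: measurable_funM; first exact: measurable_funM.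
  exact: (measurableT_comp mu measurable_fst).
apply/(integrable21ltyP L L mG).
apply: (@le_lt_trans _ _ (\int[L]_y (`|h y|%:E * (U * J (fun x => `|k x|))%:E))%E).
  apply: ge0_le_integral => //.
  - by move=> y _; apply: integral_ge0.
  - apply: (@measurable_fun_fubini_tonelli_G _ _ _ _ _ L (fun z : T * T =>
      `|(h z.2 * k (rd_sub z.1 z.2) * u z.1)%:E|%E)) => //.
    exact: (measurableT_comp (@abse_measurable _ setT) mG).
  - apply/measurable_EFinP; apply: measurable_funM => //.
    exact: (measurableT_comp (@normr_measurable _ setT) mh).
  - move=> y _.
    apply: (@le_trans _ _ (\int[L]_x (`|h y|%:E * (U%:E * `|k (rd_sub x y)|%:E)))%E).
      apply: ge0_le_integral => //.
      + apply: (measurableT_comp (@abse_measurable _ setT)).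
        apply: (measurableT_comp mG); exact: measurable_fun_pair.
      + apply/measurable_EFinP; apply: measurable_funM => //; apply: measurable_funM => //.
        apply: (measurableT_comp (@normr_measurable _ setT)).
        by apply: (measurableT_comp mk); exact: measurable_rd_sub_fun.
      + move=> x _ /=; rewrite lee_fin !normrM -mulrA ler_wpM2l//.
        by rewrite mulrC ler_wpM2r.
    rewrite (@integral_translate y (fun x => `|h y|%:E * (U%:E * `|k x|%:E))%E); last first.
      apply/measurable_EFinP; apply: measurable_funM => //; apply: measurable_funM => //.
      exact: (measurableT_comp (@normr_measurable _ setT) mk).
    have U0 : 0 <= U by apply: le_trans (uU (rd_zero R d)).
    rewrite -EFin_rd_integral; last by do 2 apply: rd_intZ; exact: rd_int_norm.
    rewrite rd_integralZ; last by apply: rd_intZ; exact: rd_int_norm.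
    by rewrite rd_integralZ ?EFinM//; exact: rd_int_norm.
under eq_integral do rewrite -EFinM.
rewrite -EFin_rd_integral ?ltry//.
have := rd_intZ (U * J (fun x => `|k x|)) (rd_int_norm Ih).
by apply: eq_rd_int => x; rewrite mulrC.
Qed.

(** The bound on [k] makes every section integrable, so the Fubini marginal is [convol h k x * u x]
    at every point and not merely almost everywhere. *)
Lemma convol_pairing (u : T -> R) (U : R) : measurable_fun [set: T] u ->
  (forall x, `|u x| <= U) ->
  [/\ rd_int (fun x => convol h k x * u x),
      rd_int (fun y => h y * J (fun x => k (rd_sub x y) * u x)) &
      J (fun x => convol h k x * u x) =
      J (fun y => h y * J (fun x => k (rd_sub x y) * u x))].
Proof.
move=> mu uU; have I2 := integrable_convol2 mu uU.
have E1 : fubini_F L (fun z : T * T => (h z.2 * k (rd_sub z.1 z.2) * u z.1)%:E) =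
    EFin \o (fun x => convol h k x * u x).
  apply/funext => x; rewrite /fubini_F /=.
  rewrite -EFin_rd_integral ?rd_integralZr//; first exact: rd_int_convol_section.
  have := rd_intZ (u x) (rd_int_convol_section x).
  by apply: eq_rd_int => y; rewrite mulrC.
have Iku y : rd_int (fun x => k (rd_sub x y) * u x).
  apply: (rd_intM (K := U)) => //.
  have := rd_int_reflect y (rd_int_reflect (rd_zero R d) Ik).
  by apply: eq_rd_int => x; rewrite rd_sub_subr.
have E2 : fubini_G L (fun z : T * T => (h z.2 * k (rd_sub z.1 z.2) * u z.1)%:E) =
    EFin \o (fun y => h y * J (fun x => k (rd_sub x y) * u x)).
  apply/funext => y; rewrite /fubini_G /=.
  under eq_integral do rewrite -mulrA.
  by rewrite -EFin_rd_integral ?rd_integralZ//; exact: rd_intZ.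
have I1 := integrable_fubini_F I2; rewrite E1 in I1.
have := Fubini I2; rewrite -/(fubini_F L _) -/(fubini_G L _).
(* The second marginal is the first marginal of the integrand with swapped variables. *)
have I3 : L.-integrable setT (fubini_G L
    (fun z : T * T => (h z.2 * k (rd_sub z.1 z.2) * u z.1)%:E)).
  have I2' : (L \x L)%E.-integrable setT
     (fun z : T * T => (h z.1 * k (rd_sub z.2 z.1) * u z.2)%:E).
    apply/(integrable12ltyP L L).
      apply/measurable_EFinP; apply: measurable_funM.
        apply: measurable_funM; first exact: (measurableT_comp mh measurable_fst).
        apply: (measurableT_comp mk).
        exact: (measurable_rd_sub_fun measurable_snd measurable_fst).
      exact: (measurableT_comp mu measurable_snd).
    by have /integrableP[mI _] := I2; have := (integrable21ltyP L L mI).1 I2.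
  exact: (integrable_fubini_F I2').
rewrite E2 in I3.
move=> FF; split => //.
congr fine; exact: (etrans (esym (congr1 (integral L setT) E1))
  (etrans FF (congr1 (integral L setT) E2))).
Qed.

Lemma rd_int_convol : rd_int (convol h k).
Proof.
have [|x|+ _ _] := @convol_pairing (fun=> 1) 1; first exact: measurable_cst.
  by rewrite normr1.
by apply: eq_rd_int => x; rewrite mulr1.
Qed.

Lemma rd_integral_translate y f : measurable_fun [set: T] f ->
  J (fun x => f (rd_sub x y)) = J f.
Proof.
move=> mf; congr fine.
by apply: (@integral_translate y (EFin \o f)); exact/measurable_EFinP.
Qed.

Lemma rd_integral_convol : J (convol h k) = J h * J k.
Proof.
have [|x|_ _ E] := @convol_pairing (fun=> 1) 1; first exact: measurable_cst.
  by rewrite normr1.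
transitivity (J (fun x => convol h k x * 1)); first by apply: eq_rd_integral => x; rewrite mulr1.
rewrite E -rd_integralZr//; apply: eq_rd_integral => y; congr (_ * _).
rewrite -(rd_integral_translate y mk); apply: eq_rd_integral => x.
by rewrite mulr1.
Qed.

Section character.
Variable xi : T.
Let c x := cos (2 * pi * rd_dot x xi).
Let s x := sin (2 * pi * rd_dot x xi).

Let mph : measurable_fun [set: T] (fun x => 2 * pi * rd_dot x xi).
Proof. by apply: measurable_funM => //; exact: measurable_rd_dot_fun. Qed.

Let mc : measurable_fun [set: T] c.
Proof. exact: measurable_cos_fun. Qed.

Let ms : measurable_fun [set: T] s.
Proof. exact: measurable_sin_fun. Qed.

Let c1 x : `|c x| <= 1.
Proof. by rewrite ler_norml cos_geN1 cos_le1. Qed.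

Let s1 x : `|s x| <= 1.
Proof. by rewrite ler_norml sin_geN1 sin_le1. Qed.

Let dot_sub x y : 2 * pi * rd_dot x xi =
  2 * pi * rd_dot (rd_sub x y) xi + 2 * pi * rd_dot y xi.
Proof.
rewrite -mulrDr; congr (_ * _); rewrite /rd_dot -big_split/=.
by apply: eq_bigr => i _; rewrite tnth_rd_sub -mulrDl subrK.
Qed.

Let cD x y : c x = c (rd_sub x y) * c y - s (rd_sub x y) * s y.
Proof. by rewrite /c /s (dot_sub x y) cosD. Qed.

Let sD x y : s x = s (rd_sub x y) * c y + c (rd_sub x y) * s y.
Proof. by rewrite /c /s (dot_sub x y) sinD. Qed.

(** Real part of the convolution theorem: pair with the cosine, write x = (x - y) + y, and use the
    addition formula and translation invariance. *)
Lemma convol_cos : J (fun x => convol h k x * c x) =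
  J (fun x => h x * c x) * J (fun x => k x * c x) -
  J (fun x => h x * s x) * J (fun x => k x * s x).
Proof.
have Ikc : rd_int (fun x => k x * c x) by apply: (rd_intM (K := 1)).
have Iks : rd_int (fun x => k x * s x) by apply: (rd_intM (K := 1)).
have Ihc : rd_int (fun x => h x * c x) by apply: (rd_intM (K := 1)).
have Ihs : rd_int (fun x => h x * s x) by apply: (rd_intM (K := 1)).
have [_ _ ->] := convol_pairing mc c1.
rewrite -!rd_integralZr// -rd_integralB; last 2 first.
- by apply: eq_rd_int (rd_intZ _ Ihc) => x; exact: mulrC.
- by apply: eq_rd_int (rd_intZ _ Ihs) => x; exact: mulrC.
apply: eq_rd_integral => y; rewrite -!mulrA -mulrBr; congr (_ * _).
rewrite -(rd_integral_translate y (rd_int_measurable Ikc)).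
rewrite -(rd_integral_translate y (rd_int_measurable Iks)).
have tr f : rd_int f -> rd_int (fun x => f (rd_sub x y)).
  move=> If; have := rd_int_reflect y (rd_int_reflect (rd_zero R d) If).
  by apply: eq_rd_int => x; rewrite rd_sub_subr.
rewrite -(rd_integralZ (c y) (tr _ Ikc)) -(rd_integralZ (s y) (tr _ Iks)).
rewrite -rd_integralB; last 2 first.
- by apply: rd_intZ; exact: (tr _ Ikc).
- by apply: rd_intZ; exact: (tr _ Iks).
by apply: eq_rd_integral => x; rewrite (cD x y); ring.
Qed.

(** The imaginary part of the convolution theorem, up to sign, by the addition formula for the
    sine. *)
Lemma convol_sin : J (fun x => convol h k x * s x) =
  J (fun x => h x * c x) * J (fun x => k x * s x) +
  J (fun x => h x * s x) * J (fun x => k x * c x).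
Proof.
have Ikc : rd_int (fun x => k x * c x) by apply: (rd_intM (K := 1)).
have Iks : rd_int (fun x => k x * s x) by apply: (rd_intM (K := 1)).
have Ihc : rd_int (fun x => h x * c x) by apply: (rd_intM (K := 1)).
have Ihs : rd_int (fun x => h x * s x) by apply: (rd_intM (K := 1)).
have [_ _ ->] := convol_pairing ms s1.
rewrite -!rd_integralZr// -rd_integralD; last 2 first.
- by apply: eq_rd_int (rd_intZ _ Ihc) => x; exact: mulrC.
- by apply: eq_rd_int (rd_intZ _ Ihs) => x; exact: mulrC.
apply: eq_rd_integral => y; rewrite -!mulrA -mulrDr; congr (_ * _).
rewrite -(rd_integral_translate y (rd_int_measurable Ikc)).
rewrite -(rd_integral_translate y (rd_int_measurable Iks)).
have tr f : rd_int f -> rd_int (fun x => f (rd_sub x y)).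
  move=> If; have := rd_int_reflect y (rd_int_reflect (rd_zero R d) If).
  by apply: eq_rd_int => x; rewrite rd_sub_subr.
rewrite -(rd_integralZ (c y) (tr _ Iks)) -(rd_integralZ (s y) (tr _ Ikc)).
rewrite -rd_integralD; last 2 first.
- by apply: rd_intZ; exact: (tr _ Iks).
- by apply: rd_intZ; exact: (tr _ Ikc).
by apply: eq_rd_integral => x; rewrite (sD x y); ring.
Qed.

End character.

End convolution.
End rd_integrals.

(** * Correlations, their cosine transforms, and the Poisson approximate identity *)

Section correlation.
Variables (R : realType) (d' : nat).
Let d := d'.+1.
Local Notation T := (d.-tuple R).
Let L : {sigma_finite_measure set T -> \bar R} := @lebesgue_d R d'.+1.
Local Notation J := (@rd_integral R d'.+1).
Implicit Types (f g h k u v : T -> R) (x y : T) (K : R).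

Definition rd_refl k x := k (rd_sub (rd_zero R d) x).
(** The cross-correlation z |-> int h(y) k(y - z) dy, whose Fourier transform is h^ conj(k^).
    Written as a convolution with a reflected kernel, it inherits the results on [convol]. *)
Definition corr h k := convol h (rd_refl k).

Definition rd_cos (xi x : T) := cos (2 * pi * rd_dot x xi).
Definition rd_sin (xi x : T) := sin (2 * pi * rd_dot x xi).

Lemma measurable_rd_cos xi : measurable_fun [set: T] (rd_cos xi).
Proof.
apply: measurable_cos_fun; apply: measurable_funM => //.
exact: measurable_rd_dot_fun.
Qed.

Lemma measurable_rd_sin xi : measurable_fun [set: T] (rd_sin xi).
Proof.
apply: measurable_sin_fun; apply: measurable_funM => //.
exact: measurable_rd_dot_fun.
Qed.

Lemma rd_cos_le1 xi x : `|rd_cos xi x| <= 1.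
Proof. by rewrite ler_norml cos_geN1 cos_le1. Qed.

Lemma rd_sin_le1 xi x : `|rd_sin xi x| <= 1.
Proof. by rewrite ler_norml sin_geN1 sin_le1. Qed.

Lemma rd_int_cos k xi : rd_int k -> rd_int (fun x => k x * rd_cos xi x).
Proof. by move=> Ik; apply: (rd_intM (K := 1)) => //; [exact: measurable_rd_cos|exact: rd_cos_le1]. Qed.

Lemma rd_int_sin k xi : rd_int k -> rd_int (fun x => k x * rd_sin xi x).
Proof. by move=> Ik; apply: (rd_intM (K := 1)) => //; [exact: measurable_rd_sin|exact: rd_sin_le1]. Qed.

Let dotN x xi : 2 * pi * rd_dot (rd_sub (rd_zero R d) x) xi = - (2 * pi * rd_dot x xi).
Proof.
rewrite -mulrN; congr (_ * _); rewrite /rd_dot -sumrN.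
by apply: eq_bigr => i _; rewrite tnth_rd_sub tnth_rd_zero sub0r mulNr.
Qed.

Lemma rd_refl_cos k xi : rd_int k ->
  J (fun x => rd_refl k x * rd_cos xi x) = J (fun x => k x * rd_cos xi x).
Proof.
move=> Ik; rewrite -[RHS](rd_integral_reflect (rd_zero R d)); last first.
  exact: (rd_int_measurable (rd_int_cos xi Ik)).
by apply: eq_rd_integral => x; rewrite /rd_cos dotN cosN.
Qed.

Lemma rd_refl_sin k xi : rd_int k ->
  J (fun x => rd_refl k x * rd_sin xi x) = - J (fun x => k x * rd_sin xi x).
Proof.
move=> Ik; rewrite -[X in - X](rd_integral_reflect (rd_zero R d)); last first.
  exact: (rd_int_measurable (rd_int_sin xi Ik)).
rewrite -mulN1r -rd_integralZ; last first.
  exact: (rd_int_reflect (rd_zero R d) (rd_int_sin xi Ik)).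
by apply: eq_rd_integral => x; rewrite /rd_sin dotN sinN /rd_refl; ring.
Qed.

Lemma rd_int_refl k : rd_int k -> rd_int (rd_refl k).
Proof. exact: rd_int_reflect. Qed.

Lemma rd_int_corr h k K : rd_int h -> rd_int k -> (forall x, `|k x| <= K) ->
  rd_int (corr h k).
Proof.
by move=> Ih Ik kK; exact: (rd_int_convol Ih (rd_int_refl Ik) (fun x => kK _)).
Qed.

(** The right side is Re(h^ conj(k^)), hence |h^|^2 when k = h: reflecting [k] flips the sign of its
    sine transform only. *)
Lemma corr_cos h k K xi : rd_int h -> rd_int k -> (forall x, `|k x| <= K) ->
  J (fun x => corr h k x * rd_cos xi x) =
  J (fun x => h x * rd_cos xi x) * J (fun x => k x * rd_cos xi x) +
  J (fun x => h x * rd_sin xi x) * J (fun x => k x * rd_sin xi x).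
Proof.
move=> Ih Ik kK; rewrite (convol_cos Ih (rd_int_refl Ik) (fun x => kK _)).
by rewrite -/(rd_cos xi) -/(rd_sin xi) rd_refl_cos// rd_refl_sin// mulrN opprK.
Qed.

Lemma corrE h k z : corr h k z = J (fun y => h y * k (rd_sub y z)).
Proof.
by apply: eq_rd_integral => y; rewrite /rd_refl rd_sub_subr.
Qed.

Lemma corr0 h k : corr h k (rd_zero R d) = J (fun y => h y * k y).
Proof.
rewrite corrE; apply: eq_rd_integral => y; congr (_ * k _).
by apply: eq_from_tnth => i; rewrite tnth_rd_sub tnth_rd_zero subr0.
Qed.

Lemma rd_int_exp_weight (e : R) : 0 < e -> rd_int (@exp_weight R e d).
Proof.
move=> e0; have [] // := @rd_int_ge0 R d' (@exp_weight R e d) ((2 / e) ^+ d).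
- exact: measurable_exp_weight.
- exact: exp_weight_ge0.
- by rewrite integral_lebesgue_dE integral_exp_weight.
Qed.

(** The formula with 1 + cos at phase 0, minus the mass (2/e)^d of the weight. *)
Lemma rd_integral_exp_weight_cos (e : R) z : 0 < e ->
  J (fun x => exp_weight e x * cos (2 * pi * rd_dot z x)) = poisson_rd e z.
Proof.
move=> e0; have IW := rd_int_exp_weight e0.
have mc : measurable_fun [set: T] (fun x => cos (2 * pi * rd_dot z x)).
  by apply: measurable_cos_fun; apply: measurable_funM => //; exact: measurable_rd_dot.
have IWc : rd_int (fun x => exp_weight e x * cos (2 * pi * rd_dot z x)).
  by apply: (rd_intM (K := 1)) => // x; rewrite ler_norml cos_geN1 cos_le1.
have E1 : J (exp_weight e (d:=d)) = (2 / e) ^+ d.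
  by rewrite /rd_integral integral_lebesgue_dE integral_exp_weight.
have := integral_exp_weight_cos e0 0 z.
rewrite -integral_lebesgue_dE -EFin_rd_integral; last first.
  have := rd_intD IW IWc; apply: eq_rd_int => x.
  by rewrite [RHS]mulrDr mulr1 add0r.
move=> [] E2.
have : J (fun x => exp_weight e x + exp_weight e x * cos (2 * pi * rd_dot z x)) =
    (2 / e) ^+ d + cos 0 * poisson_rd e z.
  by rewrite -E2; apply: eq_rd_integral => x; rewrite [RHS]mulrDr mulr1 add0r.
by rewrite rd_integralD// E1 cos0 mul1r => /addrI.
Qed.

Lemma rd_int_poisson (e : R) : 0 < e -> rd_int (@poisson_rd R e d).
Proof.
move=> e0; have [] // := @rd_int_ge0 R d' (@poisson_rd R e d) 1.
- exact: measurable_poisson_rd.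
- exact: poisson_rd_ge0.
- by rewrite integral_lebesgue_dE integral_poisson_rd.
Qed.

Lemma rd_integral_poisson (e : R) : 0 < e -> J (@poisson_rd R e d) = 1.
Proof.
by move=> e0; rewrite /rd_integral integral_lebesgue_dE integral_poisson_rd.
Qed.

(** The multiplication formula, by Fubini. The integrable weight makes the double integral
    absolutely convergent although the transform of [A] may fail to be integrable; this is what
    replaces Plancherel. *)
Lemma spectral_pairing (A : T -> R) (e : R) : 0 < e -> rd_int A ->
  rd_int (fun xi => exp_weight e xi * J (fun z => A z * rd_cos xi z)) /\
  J (fun xi => exp_weight e xi * J (fun z => A z * rd_cos xi z)) =
  J (fun z => A z * poisson_rd e z).
Proof.
move=> e0 IA; have IW := rd_int_exp_weight e0.
have mA := rd_int_measurable IA; have mW := rd_int_measurable IW.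
pose F (p : T * T) : \bar R := (exp_weight e p.1 * (A p.2 * rd_cos p.1 p.2))%:E.
have mF : measurable_fun [set: T * T] F.
  apply/measurable_EFinP; apply: measurable_funM.
    exact: (measurableT_comp mW measurable_fst).
  apply: measurable_funM; first exact: (measurableT_comp mA measurable_snd).
  apply: measurable_cos_fun; apply: measurable_funM => //.
  exact: measurable_rd_dot_fun.
have IF : (L \x L)%E.-integrable setT F.
  apply/(integrable12ltyP L L mF).
  apply: (@le_lt_trans _ _ (\int[L]_xi (exp_weight e xi * J (fun z => `|A z|))%:E)%E).
    apply: ge0_le_integral => //.
    - by move=> y _; apply: integral_ge0.
    - apply: (@measurable_fun_fubini_tonelli_F _ _ _ _ _ L (fun p => `|F p|%E)) => //.
      exact: (measurableT_comp (@abse_measurable _ setT) mF).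
    - by apply/measurable_EFinP; apply: measurable_funM.
    - move=> xi _; rewrite -rd_integralZ; last exact: rd_int_norm.
      rewrite EFin_rd_integral; last by apply: rd_intZ; exact: rd_int_norm.
      apply: ge0_le_integral => //.
      + apply: (measurableT_comp (@abse_measurable _ setT)).
        apply: (measurableT_comp mF); exact: measurable_fun_pair.
      + apply/measurable_EFinP; apply: measurable_funM => //.
        exact: (measurableT_comp (@normr_measurable _ setT) mA).
      + move=> z _ /=; rewrite lee_fin !normrM ger0_norm ?exp_weight_ge0//.
        rewrite ler_wpM2l ?exp_weight_ge0// ler_piMr//; exact: rd_cos_le1.
  rewrite -EFin_rd_integral ?ltry//.
  by apply: eq_rd_int (rd_intZ (J (fun z => `|A z|)) IW) => x; exact: mulrC.
have E1 : fubini_F L F =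
    EFin \o (fun xi => exp_weight e xi * J (fun z => A z * rd_cos xi z)).
  apply/funext => xi; rewrite /fubini_F /F /=.
  rewrite -EFin_rd_integral ?rd_integralZ//; first exact: rd_int_cos.
  by apply: rd_intZ; exact: rd_int_cos.
have E2 : fubini_G L F = EFin \o (fun z => A z * poisson_rd e z).
  apply/funext => z; rewrite /fubini_G /F /=.
  have IWc : rd_int (fun x => exp_weight e x * cos (2 * pi * rd_dot z x)).
    apply: (rd_intM (K := 1)) => // [|x].
      by apply: measurable_cos_fun; apply: measurable_funM => //; exact: measurable_rd_dot.
    by rewrite ler_norml cos_geN1 cos_le1.
  under eq_integral do rewrite mulrCA.
  rewrite -EFin_rd_integral; last exact: (rd_intZ (A z) IWc).
  by rewrite (rd_integralZ (A z) IWc) rd_integral_exp_weight_cos.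
have I1 := integrable_fubini_F IF; rewrite E1 in I1.
split => //.
congr fine; exact: (etrans (esym (congr1 (integral L setT) E1))
  (etrans (Fubini IF) (congr1 (integral L setT) E2))).
Qed.

(** A one-sided approximate-identity argument: as the kernel concentrates at 0, lower semicontinuity
    there and a global bound push the averages of [D] up to at least D(0) minus a small error. *)
Lemma poisson_limit (D : T -> R) (S M : R) : measurable_fun [set: T] D ->
  (forall z, `|D z| <= S) ->
  (forall eta : R, 0 < eta -> exists2 delta : R, 0 < delta &
     forall z, (forall i, `|tnth z i| < delta) -> D (rd_zero R d) - eta <= D z) ->
  (forall e : R, 0 < e -> J (fun z => D z * poisson_rd e z) <= M) ->
  D (rd_zero R d) <= M.
Proof.
move=> mD DS D0 DM; apply/ler_addgt0Pr => /= eta eta0.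
have [delta delta0 Hd] := D0 _ (divr_gt0 eta0 (ltr0n _ 2)).
have S0 : 0 <= S by apply: le_trans (DS (rd_zero R d)).
pose K := (1 + (2 * pi * delta) ^+ 2) / (2 * pi * delta) ^+ 2.
have K0 : 0 <= K by rewrite divr_ge0 ?addr_ge0 ?sqr_ge0.
(* Outside the cube of half-side delta the loss is at most 2S times the mass of [d] slabs, each at
   most e K. Taking e = eta/(2B) makes this at most eta/2; the summand 1 keeps [B] positive. *)
pose B := 2 * S * d%:R * K + 1.
have SK : 0 <= 2 * S * d%:R * K by do 3! apply: mulr_ge0 => //.
have B0 : 0 < B by rewrite /B; lra.
pose e := eta / 2 / B.
have e0 : 0 < e by rewrite !divr_gt0.
have eB : 2 * S * d%:R * K * e <= eta / 2.
  rewrite /e mulrCA ler_piMr ?divr_ge0 ?(ltW eta0)//.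
  by rewrite ler_pdivrMr// mul1r /B lerDl.
pose I i (z : T) : R := \1_([set s : R | delta <= `|s|]) (tnth z i).
have IC := rd_int_poisson e0; have C0 := poisson_rd_ge0 e0.
have mI i : measurable_fun [set: T] (I i).
  have mI0 : measurable_fun [set: R] (\1_([set s : R | delta <= `|s|]) : R -> R).
    apply: measurable_indic.
    rewrite -[X in measurable X]setTI.
    rewrite (_ : [set _ | _] = (fun s : R => `|s|) @^-1` `[delta, +oo[%classic); last first.
      by apply/seteqP; split => s /=; rewrite in_itv/= andbT.
    exact: (@normr_measurable R setT).
  exact: (measurableT_comp mI0 (measurable_tnth i)).
have I01 i z : 0 <= I i z <= 1 by rewrite /I indicE; case: (_ \in _); rewrite ?lexx ?ler01.
have tail i : rd_int (fun z => poisson_rd e z * I i z) /\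
    J (fun z => poisson_rd e z * I i z) <= e * K.
  apply: rd_int_ge0.
  - by apply: measurable_funM => //; exact: measurable_poisson_rd.
  - by move=> z; rewrite mulr_ge0//; have /andP[] := I01 i z.
  - by rewrite integral_lebesgue_dE; exact: integral_poisson_rd_tail.
have ICI i : rd_int (fun z => poisson_rd e z * I i z) by have [] := tail i.
have Isum : rd_int (fun z => \sum_(i < d) poisson_rd e z * I i z).
  have := @integrable_sum _ _ _ L setT measurableT _ (index_enum 'I_d) xpredT
    (fun i z => (poisson_rd e z * I i z)%:E) (fun i _ => ICI i).
  by rewrite /rd_int; congr (integrable _ _ _); apply/funext => z; rewrite /= sumEFin.
have Jsum : J (fun z => \sum_(i < d) poisson_rd e z * I i z) <= d%:R * (e * K).
  rewrite -lee_fin EFin_rd_integral//.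
  under eq_integral do rewrite -sumEFin.
  rewrite integral_sum//.
  apply: (@le_trans _ _ (\sum_(i < d) (e * K)%:E)%E); last first.
    by rewrite sumEFin sumr_const card_ord mulr_natl.
  apply: lee_sum => i _; rewrite -EFin_rd_integral// lee_fin.
  by have [] := tail i.
(* Near 0 this is the hypothesis on [D]. Elsewhere some indicator is 1, so at least 2S times the
   kernel is subtracted, and what remains is at most -S times the kernel. *)
have low z : (D (rd_zero R d) - eta / 2) * poisson_rd e z -
    2 * S * (\sum_(i < d) poisson_rd e z * I i z) <= D z * poisson_rd e z.
  have [near|] := pselect (forall i, `|tnth z i| < delta).
    apply: (@le_trans _ _ ((D (rd_zero R d) - eta / 2) * poisson_rd e z)).
      rewrite gerBl mulr_ge0 ?mulr_ge0//; apply: sumr_ge0 => i _.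
      by rewrite mulr_ge0//; have /andP[] := I01 i z.
    by rewrite ler_wpM2r// Hd.
  move=> /existsNP[i /negP]; rewrite -leNgt => far.
  have Ii : I i z = 1 by rewrite /I indicE mem_set.
  have sum_ge : poisson_rd e z <= \sum_(i < d) poisson_rd e z * I i z.
    rewrite (bigD1 i)//= Ii mulr1 lerDl; apply: sumr_ge0 => j _.
    by rewrite mulr_ge0//; have /andP[] := I01 j z.
  have := DS z; have := DS (rd_zero R d); rewrite !ler_norml => /andP[_ h1] /andP[h2 _].
  have : 2 * S * poisson_rd e z <= 2 * S * (\sum_(i < d) poisson_rd e z * I i z).
    by rewrite ler_wpM2l// mulr_ge0.
  have : (D (rd_zero R d) - eta / 2) * poisson_rd e z <= S * poisson_rd e z.
    by rewrite ler_wpM2r//; lra.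
  have : - S * poisson_rd e z <= D z * poisson_rd e z by rewrite ler_wpM2r.
  lra.
have IDC : rd_int (fun z => D z * poisson_rd e z).
  by apply: eq_rd_int (rd_intM IC mD DS) => z; exact: mulrC.
have I1 := rd_intZ (D (rd_zero R d) - eta / 2) IC.
have I2 := rd_intZ (2 * S) Isum.
have := le_rd_integral (rd_intB I1 I2) IDC low.
rewrite rd_integralB// rd_integralZ// rd_integralZ// rd_integral_poisson// mulr1.
have := DM _ e0.
have : 2 * S * J (fun z => \sum_(i < d) poisson_rd e z * I i z) <= 2 * S * (d%:R * (e * K)).
  by rewrite ler_wpM2l// mulr_ge0.
lra.
Qed.

Lemma corr_bound h k K z : rd_int h -> rd_int k -> (forall x, `|k x| <= K) ->
  `|corr h k z| <= K * J (fun x => `|h x|).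
Proof.
move=> Ih Ik kK.
have I1 := rd_int_convol_section Ih (rd_int_refl Ik)
  (fun x => kK (rd_sub (rd_zero R d) x)) z.
rewrite /corr /convol; apply: (le_trans (le_norm_rd_integral I1)).
rewrite -rd_integralZ; last exact: rd_int_norm.
apply: le_rd_integral.
- exact: rd_int_norm.
- by apply: rd_intZ; exact: rd_int_norm.
- by move=> x; rewrite normrM mulrC ler_wpM2r//; exact: kK.
Qed.

(** h(y) h(y-z) <= (h(y)^2 + h(y-z)^2)/2, and both squares have the same integral. The bound holds
    at every [z], so on the side of g = f * psi no limit at 0 has to be taken. *)
Lemma corr_self_le h K z : rd_int h -> (forall x, `|h x| <= K) ->
  corr h h z <= J (fun x => h x ^+ 2).
Proof.
move=> Ih hK; have mh := rd_int_measurable Ih.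
have Ih2 : rd_int (fun x => h x ^+ 2).
  by apply: eq_rd_int (rd_intM Ih mh hK) => x; rewrite expr2.
have Ihz : rd_int (fun y => h (rd_sub y z) ^+ 2).
  have := rd_int_reflect z (rd_int_reflect (rd_zero R d) Ih2).
  by apply: eq_rd_int => x; rewrite rd_sub_subr.
have I1 := rd_int_convol_section Ih (rd_int_refl Ih)
  (fun x => hK (rd_sub (rd_zero R d) x)) z.
have -> : J (fun x => h x ^+ 2) =
    J (fun y => 2^-1 * (h y ^+ 2 + h (rd_sub y z) ^+ 2)).
  rewrite rd_integralZ ?rd_integralD//; last exact: rd_intD.
  rewrite (@rd_integral_translate _ _ z (fun x => h x ^+ 2)); last exact: rd_int_measurable.
  by field.
rewrite corrE; apply: le_rd_integral.
- by apply: eq_rd_int I1 => y; rewrite /rd_refl rd_sub_subr.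
- by apply: rd_intZ; exact: rd_intD.
- move=> y; have := sqr_ge0 (h y - h (rd_sub y z)); rewrite !expr2; lra.
Qed.

Lemma rd_norm_le_sum (x : T) : rd_norm x <= \sum_(i < d) `|tnth x i|.
Proof.
have S0 : 0 <= \sum_(i < d) `|tnth x i| by exact: sumr_ge0.
rewrite -(ger0_norm S0) -sqrtr_sqr ler_wsqrtr// /rd_dot expr2 mulr_sumr.
apply: ler_sum => i _; rewrite -expr2 -real_normK ?num_real// expr2.
by rewrite ler_wpM2r// (bigD1 i)//= lerDl; exact: sumr_ge0.
Qed.

(** Dominated convergence with majorant K|h|, along a sequence of supposed counterexamples whose
    coordinates are below 1/(n+1); continuity of [k] gives the pointwise limit. *)
Lemma corr_continuous0 h k K : rd_int h -> rd_int k -> (forall x, `|k x| <= K) ->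
  rd_continuous k ->
  forall eta : R, 0 < eta -> exists2 delta : R, 0 < delta &
    forall z, (forall i, `|tnth z i| < delta) ->
      `|corr h k z - corr h k (rd_zero R d)| < eta.
Proof.
move=> Ih Ik kK kcont eta eta0; apply: contrapT => H.
have mh := rd_int_measurable Ih; have mk := rd_int_measurable Ik.
have H' n : exists z : T, (forall i, `|tnth z i| < n.+1%:R^-1) /\
    eta <= `|corr h k z - corr h k (rd_zero R d)|.
  apply: contrapT => Hn; apply: H; exists n.+1%:R^-1; first by rewrite invr_gt0.
  move=> z zn; rewrite ltNge; apply/negP => zeta; apply: Hn.
  by exists z.
have [z Hz] := choice H'.
pose fn n (y : T) : \bar R := (h y * k (rd_sub y (z n)))%:E.
have mks w : measurable_fun [set: T] (fun y => k (rd_sub y w)).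
  by apply: (measurableT_comp mk); exact: measurable_rd_sub_fun.
have mfn n : measurable_fun [set: T] (fn n).
  by apply/measurable_EFinP; apply: measurable_funM.
have lim y : (fn n y) @[n --> \oo] --> (h y * k y)%:E.
  apply: cvg_EFin; first by apply: nearW => n; rewrite fin_numE.
  rewrite /fn /=; apply: cvgM; first exact: cvg_cst.
  apply/cvgrPdist_lt => r r0.
  have [del del0 Hdel] := kcont y r r0.
  near=> n; rewrite distrC; apply: Hdel.
  apply: (@le_lt_trans _ _ (d%:R * n.+1%:R^-1)).
    apply: (le_trans (rd_norm_le_sum _)).
    apply: (@le_trans _ _ (\sum_(i < d) n.+1%:R^-1)); last first.
      by rewrite sumr_const card_ord mulr_natl.
    apply: ler_sum => i _; rewrite !tnth_rd_sub addrAC subrr sub0r normrN.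
    by apply: ltW; have [+ _] := Hz n; exact.
  rewrite ltr_pdivrMr// mulrC -ltr_pdivrMr//.
  near: n; exists (Num.truncn (d%:R / del)) => // n /= hn.
  apply: lt_le_trans (truncnS_gt _) _.
  by rewrite ler_nat ltnS.
pose G y : \bar R := (K * `|h y|)%:E.
have IG : L.-integrable setT G by apply: rd_intZ; exact: rd_int_norm.
have fnG n y : (`|fn n y| <= G y)%E.
  by rewrite /fn /G lee_fin normrM mulrC ler_wpM2r.
have [_ _ cvgI] := @dominated_convergence _ _ _ L setT measurableT fn
   (fun y => (h y * k y)%:E) G mfn
   (measurable_int L (rd_intM Ih mk kK))
   (aeW _ (fun y _ => lim y)) IG
   (aeW _ (fun y n _ => fnG n y)).
have IE n : (\int[L]_y fn n y)%E = (corr h k (z n))%:E.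
  rewrite corrE EFin_rd_integral//.
  apply: (rd_intM (K := K)) => // y; exact: kK.
have IE0 : (\int[L]_y (h y * k y)%:E)%E = (corr h k (rd_zero R d))%:E.
  by rewrite corr0 EFin_rd_integral//; exact: (rd_intM (K := K)).
rewrite IE0 in cvgI.
have cvgR : corr h k (z n) @[n --> \oo] --> corr h k (rd_zero R d).
  have cvgE : (corr h k (z n))%:E @[n --> \oo] --> (corr h k (rd_zero R d))%:E.
    rewrite (_ : (fun n => (corr h k (z n))%:E) = [sequence (\int[L]_x fn n x)%E]_n)//.
    by apply/funext => n; rewrite /= -IE.
  exact: (fine_cvg cvgE).
move/cvgrPdist_lt : cvgR => /(_ eta eta0) [N _ HN].
have [_] := Hz N; rewrite leNgt => /negP; apply.
by rewrite distrC; apply: HN => /=.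
Unshelve. all: by end_near. Qed.

End correlation.

(** * Comparison of L^2 norms *)

Section uncertainty.
Variables (R : realType) (d' : nat).
Let d := d'.+1.
Local Notation T := (d.-tuple R).
Let L : {sigma_finite_measure set T -> \bar R} := @lebesgue_d R d'.+1.
Local Notation J := (@rd_integral R d'.+1).
Implicit Types (f g h k u v psi : T -> R) (x y : T) (K a b c : R).

(** Truncation by clamping is 1-Lipschitz, unlike cutting [f] to 0 where it is large: the truncated
    function stays continuous, as continuity of the correlations at 0 requires. *)
Definition clamp (n x : R) : R := Num.max (- n) (Num.min n x).

Variant clamp_spec (n x : R) : R -> Prop :=
| ClampHi of n <= x : clamp_spec n x n
| ClampMid of - n <= x <= n : clamp_spec n x x
| ClampLo of x <= - n : clamp_spec n x (- n).

Lemma clamp_case (n x : R) : 0 <= n -> clamp_spec n x (clamp n x).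
Proof.
move=> n0; rewrite /clamp.
case: (leP n x) => nx; first by rewrite (max_idPr _); [exact: ClampHi|lra].
case: (leP (- n) x) => h; last exact/ClampLo/ltW.
by apply: ClampMid; rewrite h ltW.
Qed.

(** The last inequality holds since clamping keeps the sign and shrinks the modulus; it yields int
    h^2 <= int f h for the truncation h. *)
Lemma clampP (n x : R) : 0 <= n -> [/\ `|clamp n x| <= n, `|clamp n x| <= `|x| &
  clamp n x ^+ 2 <= x * clamp n x].
Proof.
move=> n0; have h1 := ler_norm x.
have h3 : - x <= `|x| by rewrite -normrN ler_norm.
case: clamp_case => // h; rewrite !ler_norml; split;
  try (by apply/andP; split; lra); rewrite ?expr2//.
  by rewrite ler_wpM2r.
by apply: ler_wnM2r => //; lra.
Qed.

Lemma clamp_dist (n x y : R) : 0 <= n -> `|clamp n x - clamp n y| <= `|x - y|.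
Proof.
move=> n0; have h1 := ler_norm (x - y).
have h3 : - (x - y) <= `|x - y| by rewrite -normrN ler_norm.
by case: (clamp_case x n0) => hx; case: (clamp_case y n0) => hy;
  rewrite ler_norml; apply/andP; split; lra.
Qed.

Lemma clamp_id (n x : R) : `|x| <= n -> clamp n x = x.
Proof.
rewrite ler_norml => /andP[h1 h2]; rewrite /clamp.
by rewrite (min_idPr h2) (max_idPr h1).
Qed.

Lemma clamp_sqr_le (n m x : R) : 0 <= n -> n <= m ->
  clamp n x ^+ 2 <= clamp m x ^+ 2.
Proof.
move=> n0 nm; have m0 := le_trans n0 nm.
case: (clamp_case x n0) => hx; case: (clamp_case x m0) => hy //;
  rewrite -subr_ge0 subr_sqr;
  by [apply: mulr_ge0; lra | apply: mulr_le0; lra].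
Qed.

Lemma complete_square_le (p q r s : R) :
  2 * (p * r + q * s) - (r ^+ 2 + s ^+ 2) <= p ^+ 2 + q ^+ 2.
Proof.
have := sqr_ge0 (p - r); have := sqr_ge0 (q - s); rewrite !sqrrB; lra.
Qed.

(** The bound is proved for every truncation of [f] with a right side independent of the level;
    monotone convergence then gives both the integrability of f^2 and the inequality. *)
Lemma bandlimited_norm_le f g c K : rd_int f -> rd_continuous f -> rd_int g ->
  (forall x, `|g x| <= K) ->
  (forall xi, J (fun x => f x * rd_cos xi x) ^+ 2 + J (fun x => f x * rd_sin xi x) ^+ 2 <=
     c ^+ 2 * (J (fun x => g x * rd_cos xi x) ^+ 2 + J (fun x => g x * rd_sin xi x) ^+ 2)) ->
  rd_int (fun x => f x ^+ 2) /\
  J (fun x => f x ^+ 2) <= c ^+ 2 * J (fun x => g x ^+ 2).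
Proof.
move=> If fcont Ig gK fg.
have mf := rd_int_measurable If.
pose h n x := clamp n.+1%:R (f x).
have n0 (n : nat) : 0 <= n.+1%:R :> R by [].
have hn n x : `|h n x| <= n.+1%:R by have [] := clampP (f x) (n0 n).
have mh n : measurable_fun [set: T] (h n).
  by apply: measurable_maxr => //; apply: measurable_minr.
have Ih n : rd_int (h n).
  apply: (rd_int_le _ _ (rd_int_norm If)) => // x.
  by have [] := clampP (f x) (n0 n).
have hcont n : rd_continuous (h n).
  move=> x e e0; have [del del0 H] := fcont x e e0; exists del => // y /H.
  exact: le_lt_trans (clamp_dist _ _ (n0 n)).
have Ih2 n : rd_int (fun x => h n x ^+ 2).
  by apply: eq_rd_int (rd_intM (Ih n) (mh n) (hn n)) => x; rewrite expr2.
have Ifh n : rd_int (fun x => f x * h n x) by exact: (rd_intM If (mh n) (hn n)).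
have bound n : J (fun x => h n x ^+ 2) <= c ^+ 2 * J (fun x => g x ^+ 2).
  have IAgg := rd_int_corr Ig Ig gK.
  have IAfh := rd_int_corr If (Ih n) (hn n).
  have IAhh := rd_int_corr (Ih n) (Ih n) (hn n).
  pose D z := 2 * corr f (h n) z - corr (h n) (h n) z.
  have mD : measurable_fun [set: T] D.
    apply: (@rd_int_measurable _ _ D).
    by apply: rd_intB => //; exact: rd_intZ.
  have D0E : D (rd_zero R d) <= c ^+ 2 * J (fun x => g x ^+ 2).
    apply: (@poisson_limit _ _ D (2 * (n.+1%:R * J (fun x => `|f x|)) +
        n.+1%:R * J (fun x => `|h n x|))) => //.
    - move=> z; apply: (le_trans (ler_normB _ _)); apply: lerD.
        by rewrite normrM ger0_norm// ler_wpM2l//; exact: (corr_bound z If (Ih n) (hn n)).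
      exact: (corr_bound z (Ih n) (Ih n) (hn n)).
    - move=> eta eta0.
      (* [D] involves the first correlation twice and the second once, so the total error stays
         below 3 eta/4. *)
      have eta4 : 0 < eta / 4 by rewrite divr_gt0.
      have [d1 d10 H1] := corr_continuous0 If (Ih n) (hn n) (hcont n) eta4.
      have [d2 d20 H2] := corr_continuous0 (Ih n) (Ih n) (hn n) (hcont n) eta4.
      exists (Num.min d1 d2); first by rewrite lt_min d10.
      move=> z zd.
      have /H1 : forall i, `|tnth z i| < d1.
        by move=> i; apply: lt_le_trans (zd i) _; rewrite ge_min lexx.
      have /H2 : forall i, `|tnth z i| < d2.
        by move=> i; apply: lt_le_trans (zd i) _; rewrite ge_min lexx orbT.
      by rewrite !ltr_norml /D => /andP[? ?] /andP[? ?]; lra.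
    - move=> e e0.
      have [Igg Egg] := spectral_pairing e0 IAgg.
      have [Ifh' Efh] := spectral_pairing e0 IAfh.
      have [Ihh Ehh] := spectral_pairing e0 IAhh.
      have IC := rd_int_poisson d' e0.
      have IfhC : rd_int (fun z => corr f (h n) z * poisson_rd e z).
        have m := rd_int_measurable IAfh.
        by apply: eq_rd_int (rd_intM IC m (fun z => corr_bound z If (Ih n) (hn n))) => z; exact: mulrC.
      have IhhC : rd_int (fun z => corr (h n) (h n) z * poisson_rd e z).
        have m := rd_int_measurable IAhh.
        by apply: eq_rd_int (rd_intM IC m (fun z => corr_bound z (Ih n) (Ih n) (hn n))) => z; exact: mulrC.
      have IggC : rd_int (fun z => corr g g z * poisson_rd e z).
        have m := rd_int_measurable IAgg.
        by apply: eq_rd_int (rd_intM IC m (fun z => corr_bound z Ig Ig gK)) => z; exact: mulrC.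
      have -> : J (fun z => D z * poisson_rd e z) =
          J (fun xi => 2 * (exp_weight e xi * J (fun z => corr f (h n) z * rd_cos xi z)) -
             exp_weight e xi * J (fun z => corr (h n) (h n) z * rd_cos xi z)).
        rewrite rd_integralB ?rd_integralZ//; last exact: rd_intZ.
        rewrite Efh Ehh -rd_integralZ// -rd_integralB//; last exact: rd_intZ.
        by apply: eq_rd_integral => z; rewrite /D; ring.
      apply: (@le_trans _ _ (J (fun xi => c ^+ 2 * (exp_weight e xi *
          J (fun z => corr g g z * rd_cos xi z))))).
        apply: le_rd_integral.
        + by apply: rd_intB => //; exact: rd_intZ.
        + exact: rd_intZ.
        + move=> xi.
          rewrite (corr_cos xi If (Ih n) (hn n)) (corr_cos xi (Ih n) (Ih n) (hn n)).
          rewrite (corr_cos xi Ig Ig gK) -!expr2.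
          set fc := J (fun x => f x * rd_cos xi x); set fs := J (fun x => f x * rd_sin xi x).
          set hc := J (fun x => h n x * rd_cos xi x); set hs := J (fun x => h n x * rd_sin xi x).
          have := fg xi; rewrite -/fc -/fs; set G := _ + _ => fgxi.
          rewrite [leRHS]mulrCA [X in X - _]mulrCA -mulrBr ler_wpM2l ?exp_weight_ge0//.
          apply: le_trans fgxi.
          exact: complete_square_le.
      rewrite rd_integralZ// Egg ler_wpM2l ?sqr_ge0//.
      apply: (@le_trans _ _ (J (fun z => J (fun x => g x ^+ 2) * poisson_rd e z))).
        apply: le_rd_integral => //; first exact: rd_intZ.
        move=> z; rewrite ler_wpM2r//; first exact: poisson_rd_ge0.
        exact: (corr_self_le z Ig gK).
      by rewrite rd_integralZ// rd_integral_poisson// mulr1.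
  (* At 0 the correlations are integrals of products: D(0) = 2 int f h - int h^2 >= int h^2. *)
  apply: le_trans D0E; rewrite /D !corr0.
  have : J (fun x => h n x ^+ 2) <= J (fun x => f x * h n x).
    by apply: le_rd_integral => // x; have [] := clampP (f x) (n0 n).
  have -> : J (fun x => h n x * h n x) = J (fun x => h n x ^+ 2).
    by apply: eq_rd_integral => x; rewrite expr2.
  lra.
apply: rd_int_ge0.
- by apply: measurable_funX.
- by move=> x; exact: sqr_ge0.
(* Once the level exceeds |f x| the truncation is inactive, so the sequence is eventually
   constant. *)
have lim x : limn (fun n => (h n x ^+ 2)%:E) = (f x ^+ 2)%:E.
  apply: lim_near_cst => //.
  exists (Num.truncn `|f x|) => // n /= fn; congr EFin; congr (_ ^+ 2).
  apply: clamp_id; apply: ltW; apply: lt_le_trans (truncnS_gt _) _.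
  by rewrite ler_nat ltnS.
under eq_integral do rewrite -lim.
have mh2 n : measurable_fun [set: T] (fun x => (h n x ^+ 2)%:E).
  by apply/measurable_EFinP; exact: measurable_funX.
have h20 n x : [set: T] x -> (0 <= (h n x ^+ 2)%:E)%E by rewrite lee_fin sqr_ge0.
have nd x : [set: T] x -> nondecreasing_seq (fun n => (h n x ^+ 2)%:E).
  by move=> _ n m nm; rewrite lee_fin clamp_sqr_le// ler_nat ltnS.
have cv := @cvg_monotone_convergence _ _ _ L setT measurableT _ mh2 h20 nd.
rewrite -(cvg_lim _ cv)//; apply: lime_le.
  by apply/cvg_ex; eexists; exact: cv.
apply: nearW => n.
by rewrite -EFin_rd_integral// lee_fin.
Qed.

End uncertainty.

(** * The uncertainty inequality *)

(** [N], [G] stand for the squared L^2 norms of f and g, [I1], [J1] for their L^1 norms, [p], [q]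
    for the measures of the negative sets. Then N^2 <= c^4 G^2 <= c^4 a^2 I1^2 J1^2 <= c^4 a^2
    (4pN)(4q b^2 N), and N^2 cancels. *)
Lemma uncertainty_arith (R : realType) (a b c I1 J1 N G p q : R) :
  0 <= a -> 0 <= I1 -> 0 <= J1 -> 0 <= G -> 0 <= p -> 0 <= q -> 0 < N ->
  N <= c ^+ 2 * G -> I1 ^+ 2 <= 4 * p * N -> J1 ^+ 2 <= 4 * q * G ->
  G <= a * I1 * J1 -> G <= b ^+ 2 * N ->
  1 <= 16 * a ^+ 2 * b ^+ 2 * c ^+ 4 * (p * q).
Proof.
move=> a0 I0 J0 G0 p0 q0 N0 h1 h2 h3 h4 h5.
have c20 : 0 <= c ^+ 2 by exact: sqr_ge0.
have H1 : N <= c ^+ 2 * (a * I1 * J1) by apply: (le_trans h1); rewrite ler_wpM2l.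
have H2 : N ^+ 2 <= (c ^+ 2 * (a * I1 * J1)) ^+ 2.
  by rewrite ler_pXn2r// nnegrE ?(ltW N0)// mulr_ge0// mulr_ge0// mulr_ge0.
have H3 : I1 ^+ 2 * J1 ^+ 2 <= (4 * p * N) * (4 * q * (b ^+ 2 * N)).
  apply: ler_pM; rewrite ?sqr_ge0//; apply: (le_trans h3).
  by rewrite ler_wpM2l// mulr_ge0.
have H4 : N ^+ 2 <= c ^+ 4 * a ^+ 2 * ((4 * p * N) * (4 * q * (b ^+ 2 * N))).
  apply: (le_trans H2).
  have -> : (c ^+ 2 * (a * I1 * J1)) ^+ 2 = c ^+ 4 * a ^+ 2 * (I1 ^+ 2 * J1 ^+ 2) by ring.
  rewrite ler_wpM2l// mulr_ge0 ?sqr_ge0//.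
  by rewrite (_ : c ^+ 4 = (c ^+ 2) ^+ 2) ?sqr_ge0//; ring.
have N20 : 0 < N ^+ 2 by rewrite exprn_gt0.
rewrite -(ler_pM2r N20) mul1r; apply: (le_trans H4).
rewrite le_eqVlt; apply/orP; left; apply/eqP; ring.
Qed.

Lemma uncertainty_constantE (R : realType) (a b c : R) :
  16 * a ^+ 2 * b ^+ 2 * c ^+ 4 = (4 * a * b * c ^+ 2) ^+ 2.
Proof. by ring. Qed.

(** With y the d-th root of X B^2, the hypothesis reads (r y)^d >= 1, which forces r y >= 1. If X
    B^2 = 0, the power is 0 because its exponent is nonzero. *)
Lemma powR_radius_bound (R : realType) (d : nat) (X B r : R) : (0 < d)%N -> 0 <= X ->
  0 <= r -> X^-1 <= r ^+ d * B ^+ 2 ->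
  powR (X * B ^+ 2) (- d%:R^-1) <= r.
Proof.
move=> d0 X0 r0 h; set Y := X * B ^+ 2.
have Y0 : 0 <= Y by rewrite mulr_ge0// sqr_ge0.
have dN0 : d%:R^-1 != 0 :> R by rewrite invr_eq0 pnatr_eq0 -lt0n.
have [->|Yneq] := eqVneq Y 0; first by rewrite powR0// oppr_eq0.
have Ypos : 0 < Y by rewrite lt_def Yneq.
have Xpos : 0 < X.
  by rewrite lt_def X0 andbT; apply: contra Yneq => /eqP X00; rewrite /Y X00 mul0r.
rewrite powRN; set y := powR Y d%:R^-1.
have y0 : 0 < y by exact: powR_gt0.
have yd : y ^+ d = Y.
  by rewrite -powR_mulrn ?(ltW y0)// /y -powRrM mulVf ?powRr1// pnatr_eq0 -lt0n.
rewrite -[leLHS]mul1r ler_pdivrMr//.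
have : 1 <= (r * y) ^+ d.
  rewrite exprMn yd /Y mulrCA -ler_pdivrMl//.
  by rewrite mulr1.
apply: contraTT; rewrite -!ltNge => ry.
by rewrite exprn_ilt1// ?mulr_ge0 ?(ltW y0)// -lt0n.
Qed.

Section uncertainty.
Variables (R : realType) (d' : nat).
Let d := d'.+1.
Local Notation T := (d.-tuple R).
Let L : {sigma_finite_measure set T -> \bar R} := @lebesgue_d R d'.+1.
Local Notation J := (@rd_integral R d'.+1).
Implicit Types (f g h k u v psi : T -> R) (x y : T) (K a b c : R).

Lemma rd_int_indic (A : set T) : measurable A -> (L A < +oo)%E ->
  rd_int (\1_A : T -> R) /\ J (\1_A) = fine (L A).
Proof.
move=> mA LA; split; last by rewrite /rd_integral integral_indic// setIT.
apply/integrableP; split; first by apply/measurable_EFinP; exact: measurable_indic.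
rewrite (eq_integral (fun x => (\1_A x)%:E)); last first.
  by move=> x _; rewrite /= ger0_norm// indicE.
by rewrite integral_indic// setIT.
Qed.

Lemma measurable_neg u : measurable_fun [set: T] u ->
  measurable [set x | u x < 0].
Proof.
move=> mu; rewrite -[X in measurable X]setTI.
rewrite (_ : [set x | _] = u @^-1` `]-oo, 0[%classic); first exact: mu.
by apply/seteqP; split => x /=; rewrite in_itv.
Qed.

Lemma negative_set_bound u : rd_int u -> rd_int (fun x => u x ^+ 2) -> J u <= 0 ->
  (L [set x | (u x < 0)%R] < +oo)%E ->
  J (fun x => `|u x|) ^+ 2 <=
  4 * fine (L [set x | u x < 0]) * J (fun x => u x ^+ 2).
Proof.
move=> Iu Iu2 Ju0 LF; have mu := rd_int_measurable Iu.
set F := [set x | u x < 0] in LF *.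
have mF : measurable F by exact: measurable_neg.
have [IF JF] := rd_int_indic mF LF.
have m1 : measurable_fun [set: T] (\1_F : T -> R) by exact: measurable_indic.
have n1 x : `|\1_F x : R| <= 1.
  by rewrite indicE; case: (x \in F); rewrite ?normr1 ?normr0.
have Iabs := rd_int_norm Iu.
have IuF : rd_int (fun x => `|u x| * \1_F x) by exact: (rd_intM Iabs m1 n1).
have H1 : J (fun x => `|u x|) <= 2 * J (fun x => `|u x| * \1_F x).
  (* Pointwise, |u| is u plus twice its negative part; dropping the nonpositive integral of u leaves
     a factor 2, which squares to the 4 of the statement. *)
  have -> : J (fun x => `|u x|) = J u + 2 * J (fun x => `|u x| * \1_F x).
    rewrite -rd_integralZ// -rd_integralD//; last exact: rd_intZ.
    apply: eq_rd_integral => x; rewrite indicE; case: (ltP (u x) 0) => ux.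
      by rewrite mem_set//= mulr1 ltr0_norm//; ring.
    rewrite memNset; first by rewrite !mulr0 addr0 ger0_norm.
    by rewrite /F /= ltNge ux.
  by rewrite gerDr.
have CS := @rd_cauchy_schwarz R d' (fun x => `|u x|) (\1_F : T -> R)
  (rd_int_measurable Iabs) m1.
have E1 : (fun x => `|u x| ^+ 2) = (fun x => u x ^+ 2).
  by apply/funext => x; rewrite real_normK ?num_real.
have E2 : (fun x => (\1_F x : R) ^+ 2) = \1_F.
  by apply/funext => x; rewrite indicE; case: (x \in F); rewrite ?expr1n ?expr0n.
rewrite E1 E2 JF in CS.
have {}CS := CS Iu2 IF.
have J0 : 0 <= J (fun x => `|u x|) by apply: rd_integral_ge0 => x.
apply: (@le_trans _ _ ((2 * J (fun x => `|u x| * \1_F x)) ^+ 2)).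
  by rewrite ler_pXn2r// nnegrE// (le_trans J0).
rewrite exprMn -mulrA (mulrC (fine _)).
by rewrite (_ : 2 ^+ 2 = 4 :> R) ?ler_wpM2l// -natrX.
Qed.

Lemma convol_bound h k K z : rd_int h -> rd_int k -> (forall x, `|k x| <= K) ->
  `|convol h k z| <= K * J (fun x => `|h x|).
Proof.
move=> Ih Ik kK; have I1 := rd_int_convol_section Ih Ik kK z.
rewrite /convol; apply: (le_trans (le_norm_rd_integral I1)).
rewrite -rd_integralZ; last exact: rd_int_norm.
apply: le_rd_integral.
- exact: rd_int_norm.
- by apply: rd_intZ; exact: rd_int_norm.
- by move=> x; rewrite normrM mulrC ler_wpM2r.
Qed.

(** Young's inequality for L^2 * L^1: split |h||k| as sqrt|k| times |h| sqrt|k|, apply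
    Cauchy-Schwarz at each point, and integrate the resulting convolution of h^2 with |k|. *)
Lemma young_convol_sqr h k K : rd_int h -> rd_int (fun x => h x ^+ 2) -> rd_int k ->
  (forall x, `|k x| <= K) ->
  J (fun x => convol h k x ^+ 2) <=
  J (fun x => `|k x|) ^+ 2 * J (fun x => h x ^+ 2).
Proof.
move=> Ih Ih2 Ik kK; have mh := rd_int_measurable Ih; have mk := rd_int_measurable Ik.
have Ik' := rd_int_norm Ik.
have kK' x : `| `|k x| | <= K by rewrite normr_id.
have Ig := rd_int_convol Ih Ik kK; have mg := rd_int_measurable Ig.
have Ig2 : rd_int (fun x => convol h k x ^+ 2).
  by apply: eq_rd_int (rd_intM Ig mg (fun z => convol_bound z Ih Ik kK)) => x; rewrite expr2.
set b := J (fun x => `|k x|).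
apply: (@le_trans _ _ (J (fun x => b * convol (fun x => h x ^+ 2) (fun x => `|k x|) x))).
  apply: le_rd_integral => //.
    by apply: rd_intZ; exact: (rd_int_convol Ih2 Ik' kK').
  move=> x.
  have mkx : measurable_fun [set: T] (fun y => k (rd_sub x y)).
    exact: (measurableT_comp mk (measurable_rd_sub x)).
  have msq : measurable_fun [set: T] (fun y => Num.sqrt `|k (rd_sub x y)|).
    apply: (measurableT_comp (continuous_measurable_fun (@sqrt_continuous R))).
    exact: (measurableT_comp (@normr_measurable _ setT) mkx).
  have mhs : measurable_fun [set: T] (fun y => `|h y| * Num.sqrt `|k (rd_sub x y)|).
    by apply: measurable_funM => //; exact: (measurableT_comp (@normr_measurable _ setT) mh).
  have CS := rd_cauchy_schwarz msq mhs.
  have E1 : (fun y => Num.sqrt `|k (rd_sub x y)| ^+ 2) = (fun y => `|k (rd_sub x y)|).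
    by apply/funext => y; rewrite sqr_sqrtr.
  have E2 : (fun y => (`|h y| * Num.sqrt `|k (rd_sub x y)|) ^+ 2) =
      (fun y => h y ^+ 2 * `|k (rd_sub x y)|).
    by apply/funext => y; rewrite exprMn sqr_sqrtr// real_normK ?num_real.
  have E3 : (fun y => Num.sqrt `|k (rd_sub x y)| * (`|h y| * Num.sqrt `|k (rd_sub x y)|)) =
      (fun y => `|h y * k (rd_sub x y)|).
    apply/funext => y; rewrite mulrCA -expr2 sqr_sqrtr// normrM//.
  rewrite E1 E2 E3 in CS.
  have {}CS := CS (rd_int_reflect x Ik') (rd_int_convol_section Ih2 Ik' kK' x).
  have Eb : J (fun y => `|k (rd_sub x y)|) = b.
    exact: (rd_integral_reflect x (rd_int_measurable Ik')).
  rewrite Eb in CS; apply: le_trans CS.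
  rewrite -real_normK ?num_real// ler_pXn2r// ?nnegrE//.
    exact: (le_norm_rd_integral (rd_int_convol_section Ih Ik kK x)).
  by apply: rd_integral_ge0 => y.
rewrite rd_integralZ; last exact: (rd_int_convol Ih2 Ik' kK').
by rewrite (rd_integral_convol Ih2 Ik' kK') -/b expr2 -mulrA (mulrC b (J _)).
Qed.

Lemma rd_integral_sqr_gt0 f x0 : rd_continuous f -> rd_int (fun x => f x ^+ 2) ->
  f x0 != 0 -> 0 < J (fun x => f x ^+ 2).
Proof.
move=> fcont If2 fx0.
have m0 : 0 < `|f x0| / 2 by rewrite divr_gt0// normr_gt0.
have [del del0 H] := fcont x0 _ m0.
(* The Euclidean norm is at most the sum of the d coordinates, so in the box of half-side r it stays
   below d del/(d+1) < del, and there |f| >= |f x0|/2. *)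
pose r := del / d.+1%:R.
have r0 : 0 < r by rewrite divr_gt0.
pose lo : T := [tuple tnth x0 i - r | i < d].
pose hi : T := [tuple tnth x0 i + r | i < d].
have lohi i : tnth lo i <= tnth hi i by rewrite !tnth_mktuple; lra.
pose A := rd_box lo hi.
have mA : measurable A by exact: measurable_rd_box.
have LA : L A = (rd_boxvol lo hi)%:E by exact: lebesgue_d_box.
have vol0 : 0 < rd_boxvol lo hi.
  by apply: prodr_gt0 => i _; rewrite !tnth_mktuple; lra.
have [IA JA] : rd_int (\1_A : T -> R) /\ J (\1_A) = fine (L A).
  by apply: rd_int_indic => //; rewrite LA ltry.
rewrite LA /= in JA.
apply: (@lt_le_trans _ _ (J (fun x => (`|f x0| / 2) ^+ 2 * \1_A x))).
  by rewrite rd_integralZ// JA mulr_gt0// exprn_gt0.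
apply: le_rd_integral => //; first exact: rd_intZ.
move=> x; rewrite indicE; case: (boolP (x \in A)) => [/set_mem xA|_]; last first.
  by rewrite mulr0 sqr_ge0.
rewrite mulr1 -[f x ^+ 2]real_normK ?num_real// ler_pXn2r ?nnegrE ?(ltW m0)//.
have xx0 : rd_norm (rd_sub x x0) < del.
  apply: (le_lt_trans (rd_norm_le_sum _)).
  apply: (@le_lt_trans _ _ (\sum_(i < d) r)).
    apply: ler_sum => i _; rewrite tnth_rd_sub.
    have := xA i; rewrite !tnth_mktuple ler_norml; lra.
  rewrite sumr_const card_ord -mulr_natl /r mulrCA -ltr_pdivlMl// mulVf ?gt_eqF//.
  by rewrite ltr_pdivrMr// mul1r ltr_nat.
have := H x xx0; have := ler_normB (f x) (f x - f x0); rewrite subKr.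
lra.
Qed.

(** Here [a] bounds |psi| at every point, so f * psi is a finite integral everywhere and the
    convolution lemmas apply directly. *)
Theorem bounded_uncertainty f psi a c : rd_int psi -> (forall x, `|psi x| <= a) ->
  0 <= fourier_re psi (rd_zero R d) ->
  (forall xi, xi \in unit_ball R d -> 1 <= c * fourier_abs psi xi) ->
  PW f -> (exists x, f x != 0) -> J f <= 0 ->
  (((16 * a ^+ 2 * J (fun x => `|psi x|) ^+ 2 * c ^+ 4)^-1)%:E <=
   L [set x | (f x < 0)%R] * L [set xi | (convol f psi xi < 0)%R])%E.
Proof.
move=> Ipsi psia psi0 cpsi [fcont [fint fsupp]] [x0 fx0] Jf0.
have If := (rd_integrableP f).1 fint.
set b := J (fun x => `|psi x|).
pose g := convol f psi.
have Ig : rd_int g by exact: (rd_int_convol If Ipsi psia).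
have mg := rd_int_measurable Ig.
pose I1 := J (fun x => `|f x|).
have gK x : `|g x| <= a * I1 by exact: convol_bound.
have a0 : 0 <= a by apply: le_trans (psia x0).
(* A frequency where the transform is nonzero lies in the support, being its own witness at every
   scale. *)
have ball0 xi : ~ unit_ball R d xi -> fourier_re f xi = 0 /\ fourier_im f xi = 0.
  move=> xiB; have /existsNP[e /not_implyP[e0 H]] : ~ fourier_support f xi.
    by move=> /fsupp.
  have self : rd_norm (rd_sub xi xi) < e.
    rewrite /rd_norm /rd_dot big1 ?sqrtr0// => i _.
    by rewrite tnth_rd_sub subrr mul0r.
  split; apply/eqP; apply: contrapT => /negP h; apply: H; exists xi; split => //.
    by left.
  by right.
have [If2 Nle] : rd_int (fun x => f x ^+ 2) /\
    J (fun x => f x ^+ 2) <= c ^+ 2 * J (fun x => g x ^+ 2).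
  apply: (bandlimited_norm_le If fcont Ig gK) => xi.
  rewrite (convol_cos If Ipsi psia) (convol_sin If Ipsi psia).
  rewrite -/(rd_cos xi) -/(rd_sin xi).
  set fc := J (fun x => f x * rd_cos xi x); set fs := J (fun x => f x * rd_sin xi x).
  set pc := J (fun x => psi x * rd_cos xi x); set ps := J (fun x => psi x * rd_sin xi x).
  (* Multiplicativity of the modulus: |f^ psi^|^2 = |f^|^2 |psi^|^2. *)
  have -> : (fc * pc - fs * ps) ^+ 2 + (fc * ps + fs * pc) ^+ 2 =
    (fc ^+ 2 + fs ^+ 2) * (pc ^+ 2 + ps ^+ 2).
    by move: fc fs pc ps => *; ring.
  have [xiB|xiB] := pselect (unit_ball R d xi); last first.
    have [h1 h2] := ball0 _ xiB.
    have fc0 : fc = 0 by exact: h1.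
    have fs0 : fs = 0 by apply/eqP; rewrite -oppr_eq0; apply/eqP; exact: h2.
    by rewrite fc0 fs0 !expr0n/= addr0 mul0r mulr0.
  have := cpsi xi (mem_set xiB).
  rewrite /fourier_abs.
  have -> : fourier_re psi xi = pc by [].
  have -> : fourier_im psi xi = - ps by [].
  rewrite sqrrN => h.
  have P0 : 0 <= pc ^+ 2 + ps ^+ 2 by rewrite addr_ge0 ?sqr_ge0.
  have h2 : 1 <= c ^+ 2 * (pc ^+ 2 + ps ^+ 2).
    rewrite -[X in _ * X]sqr_sqrtr// -exprMn -[leLHS](expr1n _ 2).
    by rewrite ler_pXn2r// nnegrE// (le_trans _ h).
  by rewrite mulrCA ler_peMr// addr_ge0 ?sqr_ge0.
pose N := J (fun x => f x ^+ 2); pose G2 := J (fun x => g x ^+ 2).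
pose J1 := J (fun x => `|g x|).
have Ig2 : rd_int (fun x => g x ^+ 2).
  by apply: eq_rd_int (rd_intM Ig mg gK) => x; rewrite expr2.
have N0 : 0 < N by exact: (rd_integral_sqr_gt0 fcont If2 fx0).
have G0 : 0 <= G2 by apply: rd_integral_ge0 => x; exact: sqr_ge0.
have I10 : 0 <= I1 by apply: rd_integral_ge0.
have J10 : 0 <= J1 by apply: rd_integral_ge0.
have G2le : G2 <= a * I1 * J1.
  rewrite /J1 -rd_integralZ; last exact: rd_int_norm.
  apply: le_rd_integral => //; first by apply: rd_intZ; exact: rd_int_norm.
  by move=> x; rewrite -real_normK ?num_real// expr2 ler_wpM2r.
have G2b : G2 <= b ^+ 2 * N by exact: (young_convol_sqr If If2 Ipsi psia).
have Jg0 : J g <= 0.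
  rewrite (rd_integral_convol If Ipsi psia).
  have -> : J psi = fourier_re psi (rd_zero R d).
    apply: eq_rd_integral => x.
    have -> : rd_dot x (rd_zero R d) = 0.
      by rewrite /rd_dot big1// => i _; rewrite tnth_rd_zero mulr0.
    by rewrite mulr0 cos0 mulr1.
  exact: mulr_le0_ge0.
set F := [set x | f x < 0]; set G := [set xi | convol f psi xi < 0].
(* If one negative set had infinite measure, the product would still be 0 when the other is null. A
   null set would make the L^1 norm vanish, then [G2], then [N], against f != 0. *)
have pos_F : L F != 0%E.
  apply/eqP => F0.
  have := negative_set_bound If If2 Jf0; rewrite -/F F0 /= mulr0 mul0r ltry => /(_ isT).
  rewrite -/I1 => I1le; have I1E : I1 = 0.
    by apply/eqP; rewrite -sqrf_eq0 eq_le I1le sqr_ge0.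
  have : G2 <= 0 by rewrite (le_trans G2le)// I1E mulr0 mul0r.
  move=> G2le0; have : N <= 0 by rewrite (le_trans Nle)// mulr_ge0_le0 ?sqr_ge0.
  by rewrite leNgt N0.
have pos_G : L G != 0%E.
  apply/eqP => G00.
  have := negative_set_bound Ig Ig2 Jg0; rewrite -/G G00 /= mulr0 mul0r ltry => /(_ isT).
  rewrite -/J1 => J1le; have J1E : J1 = 0.
    by apply/eqP; rewrite -sqrf_eq0 eq_le J1le sqr_ge0.
  have : G2 <= 0 by rewrite (le_trans G2le)// J1E mulr0.
  move=> G2le0; have : N <= 0 by rewrite (le_trans Nle)// mulr_ge0_le0 ?sqr_ge0.
  by rewrite leNgt N0.
have F_gt0 : (0 < L F)%E by rewrite lt_def pos_F measure_ge0.
have G_gt0 : (0 < L G)%E by rewrite lt_def pos_G measure_ge0.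
have [Ffin|] := boolP (L F \is a fin_num); last first.
  by rewrite ge0_fin_numE ?measure_ge0// -leNgt leye_eq => /eqP ->; rewrite gt0_mulye// leey.
have [Gfin|] := boolP (L G \is a fin_num); last first.
  by rewrite ge0_fin_numE ?measure_ge0// -leNgt leye_eq => /eqP ->; rewrite gt0_muley// leey.
have Flty : (L F < +oo)%E by rewrite -ge0_fin_numE ?measure_ge0.
have Glty : (L G < +oo)%E by rewrite -ge0_fin_numE ?measure_ge0.
rewrite -(fineK Ffin) -(fineK Gfin) -EFinM lee_fin.
have key := uncertainty_arith a0 I10 J10 G0 (fine_ge0 (measure_ge0 L F))
  (fine_ge0 (measure_ge0 L G)) N0 Nle (negative_set_bound If If2 Jf0 Flty)
  (negative_set_bound Ig Ig2 Jg0 Glty) G2le G2b.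
set X := 16 * a ^+ 2 * b ^+ 2 * c ^+ 4 in key *.
have X0 : 0 <= X.
  by rewrite /X uncertainty_constantE sqr_ge0.
(* The inverse of 0 is 0 by convention, so the bound is trivial in this case. *)
have [->|Xneq] := eqVneq X 0.
  by rewrite invr0 mulr_ge0 ?fine_ge0 ?measure_ge0.
have Xpos : 0 < X by rewrite lt_def Xneq.
by rewrite -[leLHS]mulr1 ler_pdivrMl.
Qed.

End uncertainty.

(** * From bounded to essentially bounded [psi] *)

Section truncation.
Variables (R : realType) (d' : nat).
Let d := d'.+1.
Local Notation T := (d.-tuple R).
Let L : {sigma_finite_measure set T -> \bar R} := @lebesgue_d R d'.+1.
Local Notation J := (@rd_integral R d'.+1).
Implicit Types (f g h k u v psi : T -> R) (x y : T) (K a b c : R).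

(** The infimum defining the essential supremum is attained: the superlevel set at [a] is the
    countable union of the null superlevel sets at a + 1/(n+1). *)
Lemma Linf_norm_null psi a : Linf_norm psi = a%:E ->
  L [set x | (a < `|psi x|)%R] = 0%E.
Proof.
move=> Ha.
have H n : exists y : \bar R, (y < (a + n.+1%:R^-1)%:E)%E /\
    L [set x | (y < (`|psi x|)%:E)%E] = 0%E.
  have n0 : 0 < n.+1%:R^-1 :> R by rewrite invr_gt0.
  have Hfin : Linf_norm psi \is a fin_num by rewrite Ha.
  have [y Sy] := lb_ereal_inf_adherent n0 Hfin.
  by rewrite -/(Linf_norm psi) Ha => ylt; exists y.
have null n : L [set x | (a + n.+1%:R^-1 < `|psi x|)%R] = 0%E.
  have [y [ya Ly]] := H n.
  apply/eqP; rewrite eq_le -{1}Ly outer_measure_ge0 andbT.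
  apply: (@le_lebesgue_d R d') => x /= ax.
  by apply: (lt_trans ya); rewrite lte_fin.
have -> : [set x | (a < `|psi x|)%R] =
    \bigcup_n [set x | (a + n.+1%:R^-1 < `|psi x|)%R].
  apply/seteqP; split => x /=.
    move=> ax; have e0 : 0 < `|psi x| - a by rewrite subr_gt0.
    exists (Num.truncn (`|psi x| - a)^-1) => //=.
    rewrite -ltrBrDl invf_plt ?posrE//; exact: truncnS_gt.
  by move=> [n _ /=]; apply: le_lt_trans; rewrite lerDl invr_ge0.
apply/eqP; rewrite eq_le outer_measure_ge0 andbT.
apply: le_trans (lebesgue_d_sigma_subadditive _) _.
by rewrite eseries0// => n _ _; exact: null.
Qed.

Lemma eq_integral_null u v (N : set T) : measurable_fun [set: T] u ->
  measurable_fun [set: T] v -> measurable N -> L N = 0%E ->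
  (forall x, ~ N x -> u x = v x) ->
  (\int[L]_x (u x)%:E = \int[L]_x (v x)%:E)%E.
Proof.
move=> mu mv mN N0 uv; apply: ae_eq_integral => //.
- exact/measurable_EFinP.
- exact/measurable_EFinP.
- exists N; split => // x /= /not_implyP[_ h]; apply: contrapT => /uv uvx.
  by apply: h; rewrite uvx.
Qed.

(** [psi] is set to 0 on the null set where |psi| > a. No integral changes, so the L^1 norm, the
    Fourier transform and the convolution are those of the modified function, to which the bounded
    case applies. *)
Theorem essentially_bounded_uncertainty f psi a b c :
  measurable_fun [set: T] psi ->
  Linf_norm psi = a%:E -> L1_norm psi = b%:E ->
  0 <= fourier_re psi (rd_zero R d) ->
  (forall xi, xi \in unit_ball R d -> 1 <= c * fourier_abs psi xi) ->
  PW f -> (exists x, f x != 0) -> (\int[@lebesgue_d R d]_x (f x)%:E <= 0)%E ->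
  (((16 * a ^+ 2 * b ^+ 2 * c ^+ 4)^-1)%:E <=
   L [set x | (f x < 0)%R] * L [set xi | (convol f psi xi < 0)%R])%E.
Proof.
move=> mpsi Ha Hb psi0 cpsi fPW fn0 Jf0.
pose N := [set x | (a < `|psi x|)%R].
have N0 : L N = 0%E by exact: Linf_norm_null.
have mN : measurable N.
  rewrite -[X in measurable X]setTI.
  rewrite (_ : N = (fun x => `|psi x|) @^-1` `]a, +oo[%classic).
    exact: (measurableT_comp (@normr_measurable _ setT) mpsi).
  by apply/seteqP; split => x /=; rewrite in_itv/= andbT.
(* A negative [a] would make the null set [N] the whole space, which contains a unit cube of measure
   1. *)
have a0 : 0 <= a.
  rewrite leNgt; apply/negP => a0.
  pose one : T := [tuple 1%R | _ < d].
  have : (L (rd_box (rd_zero R d) one) <= L N)%E.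
    apply: (@le_lebesgue_d R d') => x _; rewrite /N /=.
    exact: lt_le_trans a0 _.
  have -> : L (rd_box (rd_zero R d) one) = (rd_boxvol (rd_zero R d) one)%:E.
    by apply: lebesgue_d_box => i; rewrite !tnth_mktuple.
  rewrite N0 lee_fin leNgt prodr_gt0// => i _.
  by rewrite !tnth_mktuple subr0.
pose psi' x := psi x * \1_(~` N) x.
have mpsi' : measurable_fun [set: T] psi'.
  by apply: measurable_funM => //; apply: measurable_indic; exact: measurableC.
have psiE x : ~ N x -> psi x = psi' x.
  by move=> Nx; rewrite /psi' indicE mem_set// mulr1.
have psia x : `|psi' x| <= a.
  have [Nx|Nx] := pselect (N x).
    by rewrite /psi' indicE memNset ?mulr0 ?normr0//; exact.
  by rewrite -psiE// leNgt; exact/negP.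
have Eint : (\int[L]_x (`|psi' x|)%:E)%E = b%:E.
  rewrite -Hb; apply: (eq_integral_null (N := N)) => //.
  - exact: (measurableT_comp (@normr_measurable _ setT) mpsi').
  - exact: (measurableT_comp (@normr_measurable _ setT) mpsi).
  - by move=> x Nx; rewrite psiE.
have Ipsi' : rd_int psi'.
  apply/integrableP; split; first exact/measurable_EFinP.
  by rewrite Eint ltry.
have Jb : J (fun x => `|psi' x|) = b by rewrite /rd_integral Eint.
have Ff u : measurable_fun [set: T] u ->
    J (fun x => psi x * u x) = J (fun x => psi' x * u x).
  move=> mu; congr fine; apply: (eq_integral_null (N := N)) => //.
  - exact: measurable_funM.
  - exact: measurable_funM.
  - by move=> x Nx; rewrite psiE.
have Fre xi : fourier_re psi xi = fourier_re psi' xi.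
  exact: (Ff _ (measurable_rd_cos xi)).
have Fim xi : fourier_im psi xi = fourier_im psi' xi.
  by congr (- _); exact: (Ff _ (measurable_rd_sin xi)).
have [_ [fint _]] := fPW; have If := (rd_integrableP f).1 fint.
have mf := rd_int_measurable If.
(* The exceptional set in the variable [y] is x - N, null for each [x] by reflection invariance;
   hence equality at every point and equal negative sets. *)
have Cv x : convol f psi x = convol f psi' x.
  congr fine; apply: (eq_integral_null (N := rd_sub x @^-1` N)).
  - apply: measurable_funM => //; exact: (measurableT_comp mpsi (measurable_rd_sub x)).
  - apply: measurable_funM => //; exact: (measurableT_comp mpsi' (measurable_rd_sub x)).
  - by rewrite -[X in measurable X]setTI; exact: measurable_rd_sub.
  - by rewrite -N0; exact: lebesgue_d_reflect.
  - by move=> y Ny; rewrite psiE.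
have -> : [set xi | (convol f psi xi < 0)%R] = [set xi | (convol f psi' xi < 0)%R].
  by apply/seteqP; split => x /=; rewrite Cv.
rewrite -Jb; apply: bounded_uncertainty => //.
- by rewrite -Fre.
- move=> xi /cpsi; rewrite /fourier_abs Fre Fim; exact.
- by rewrite -lee_fin EFin_rd_integral.
Qed.

End truncation.

Theorem mainTheorem18 (R : realType) (d : nat) (hd : (1 <= d)%N)
  (psi : d.-tuple R -> R) (a b c : R) (f : d.-tuple R -> R) :
  (* psi in L^1 cap L^oo, real-valued, a = ||psi||_oo, b = ||psi||_1 *)
  measurable_fun [set: d.-tuple R] psi ->
  Linf_norm psi = a%:E ->
  L1_norm psi = b%:E ->
  (* \hat psi(0) >= 0 *)
  0 <= fourier_re psi (rd_zero R d) ->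
  0 < c ->
  (forall xi, xi \in unit_ball R d -> 1 <= c * fourier_abs psi xi) ->
  (* f in PW_d \ {0}, int f <= 0 *)
  PW f ->
  (exists x, f x != 0) ->
  (\int[@lebesgue_d R d]_x (f x)%:E <= 0)%E ->
  (lebesgue_d [set x | (f x < 0)%R] *
     lebesgue_d [set xi | (convol f psi xi < 0)%R] >=
   ((16 * a ^+ 2 * b ^+ 2 * c ^+ 4)^-1)%:E)%E /\
  (forall r1 r2 : R, 0 < r1 -> 0 < r2 ->
     (forall x, r1 <= rd_norm x -> 0 <= f x) ->
     (forall xi, r2 <= rd_norm xi -> 0 <= convol f psi xi) ->
     r1 * r2 >= powR (16 * a ^+ 2 * b ^+ 2 * c ^+ 4 *
                        fine (@lebesgue_d R d (unit_ball R d)) ^+ 2)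
                     (- (d%:R)^-1)).
Proof.
case: d hd psi f => // d' _ psi f mpsi Ha Hb psi0 c0 cpsi fPW fn0 Jf0.
have main := essentially_bounded_uncertainty mpsi Ha Hb psi0 cpsi fPW fn0 Jf0.
split=> // r1 r2 r10 r20 f1 g2.
(* The negative set lies in the ball of radius r, of measure at most r^d |B|; multiplying the two
   such bounds gives (r1 r2)^d |B|^2, and a d-th root remains to be taken. *)
have negative_ball (u : d'.+1.-tuple R -> R) r : 0 < r ->
    (forall x, r <= rd_norm x -> 0 <= u x) ->
    (lebesgue_d [set x | (u x < 0)%R] <=
     (r ^+ d'.+1 * fine (@lebesgue_d R d'.+1 (unit_ball R d'.+1)))%:E)%E.
  move=> r0 ur.
  apply: (@le_trans _ _ (lebesgue_d [set x : d'.+1.-tuple R | (rd_norm x <= r)%R])).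
    apply: le_lebesgue_d => x /= ux; rewrite leNgt; apply/negP => /ltW /ur.
    by rewrite leNgt ux.
  apply: (le_trans (lebesgue_d_ball_le _ r0)).
  rewrite EFinM fineK// ge0_fin_numE ?lebesgue_d_ge0//.
  exact: lebesgue_d_unit_ball_lty.
set V := fine _ in negative_ball *.
apply: powR_radius_bound => //.
- by rewrite uncertainty_constantE sqr_ge0.
- by rewrite mulr_ge0 ?ltW.
rewrite -lee_fin; apply: (le_trans main).
apply: (le_trans (lee_pmul _ _ (negative_ball _ _ r10 f1) (negative_ball _ _ r20 g2))).
- exact: lebesgue_d_ge0.
- exact: lebesgue_d_ge0.
rewrite -EFinM lee_fin le_eqVlt; apply/orP; left; apply/eqP.
by rewrite exprMn mulrACA -expr2.
Qed.
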